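(* Let $n\ge 1$, $0<\alpha<n$ and $0<q<\infty$, and suppose that $\sigma$ is a weak $A_\infty$ weight on $\mathbf{R}^n$. Then there exist constants $\tau>1$ and $C,c>0$, depending only on $n$, $q$, $\alpha$ and the weak $A_\infty$ character of $\sigma$, such that for every nonnegative measure $\mu$ on $\mathbf{R}^n$, every $\lambda>0$ and every $0<\epsilon<1$, $$\bigl|\{x\in\mathbf{R}^n : \mathbf{T}^q_\alpha(\mu)(x)>\tau\lambda,\ \mathbf{M}_\alpha(\mu)(x)\le\epsilon\lambda\}\bigr|_\sigma\le C e^{-c/\epsilon^q}\,\bigl|\{x\in\mathbf{R}^n : \mathbf{T}^q_\alpha(\mu)(x)>\lambda\}\bigr|_\sigma .$$
   Context: For a nonnegative (Borel) measure $\mu$ on $\mathbf{R}^n$, $0<\alpha<n$ and $0<q<\infty$, the nonlinear potential is $$\mathbf{T}^q_\alpha(\mu)(x)=\Bigl(\int_0^\infty\Bigl(\frac{\mu(B(x,r))}{r^{n-\alpha}}\Bigr)^q\frac{dr}{r}\Bigr)^{1/q},$$ and the fractional maximal operator (the case $q=\infty$) is $\mathbf{M}_\alpha(\mu)(x)=\sup_{r>0}\mu(B(x,r))\,r^{\alpha-n}$. Here $B(x,r)$ is the ball with center $x$ and radius $r$. A nonnegative measurable function $\sigma$ on $\mathbf{R}^n$ is a weak $A_\infty$ weight if there exist constants $C_\sigma>0$ and $\theta>0$ such that for each cube $Q$ and each measurable set $E\subset Q$, $$\frac{|E|_\sigma}{|2Q|_\sigma}\le C_\sigma\Bigl(\frac{|E|}{|Q|}\Bigr)^\theta$$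 (i.e. $|E|_\sigma\le C_\sigma(|E|/|Q|)^\theta|2Q|_\sigma$), where $|E|$ is Lebesgue measure, $|E|_\sigma=\int_E\sigma\,dx$, and $2Q$ is the concentric double of $Q$. A constant depends on the weak $A_\infty$ character of $\sigma$ if it depends on $\theta$ and $C_\sigma$. *)

(* Defs.v *)
From HB Require Import structures.
From mathcomp Require Import all_boot all_order all_algebra.
From mathcomp Require Import all_classical all_reals all_analysis.
Set Implicit Arguments.
Unset Strict Implicit.
Unset Printing Implicit Defensive.
Import Order.TTheory GRing.Theory Num.Theory.
Import numFieldNormedType.Exports.

Local Open Scope classical_set_scope.
Local Open Scope ring_scope.
Local Open Scope ereal_scope.

(* R^n with its Borel sigma-algebra, which is the product sigma-algebra that
   the library puts on tuples. *)
Definition Rn (R : realType) (n : nat) : measurableType _ :=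
  n.-tuple (measurableTypeR R).

Definition Rn_cons (R : realType) (n : nat) (p : measurableTypeR R * Rn R n) :
  Rn R n.+1 := cons_tuple p.1 p.2.

Lemma measurable_Rn_cons (R : realType) (n : nat) :
  measurable_fun [set: measurableTypeR R * Rn R n] (@Rn_cons R n).
Proof. by apply: measurable_cons. Qed.

Section borel_step.
Context (R : realType) (n : nat).
Variable m : {sigma_finite_measure set (Rn R n) -> \bar R}.

Definition borel_step : set (Rn R n.+1) -> \bar R :=
  pushforward (@lebesgue_measure R \x m) (@Rn_cons R n).

Let borel_step0 : borel_step set0 = 0.
Proof. by rewrite /borel_step /pushforward preimage_set0 measure0. Qed.

Let borel_step_ge0 A : 0 <= borel_step A.
Proof. exact: (measure_ge0 (@lebesgue_measure R \x m)). Qed.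

Let borel_step_sigma_additive : semi_sigma_additive borel_step.
Proof.
move=> F mF tF mUF; rewrite /borel_step /pushforward preimage_bigcup.
have mP k : measurable (@Rn_cons R n @^-1` F k).
  by rewrite -[X in measurable X]setTI; exact: measurable_Rn_cons.
apply: measure_semi_sigma_additive => //.
- apply/trivIsetP => /= i j _ _ ij; rewrite -preimage_setI.
  by move/trivIsetP : tF => /(_ _ _ _ _ ij) ->//; rewrite preimage_set0.
- by rewrite -preimage_bigcup -[X in measurable X]setTI; exact: measurable_Rn_cons.
Qed.

HB.instance Definition _ := isMeasure.Build _ _ _ borel_step
  borel_step0 borel_step_ge0 borel_step_sigma_additive.

Let borel_step_sigma_finite : sigma_finite setT borel_step.
Proof.
have /sigma_finiteP[F [FT ndF Foo]] := sigma_finiteT (@lebesgue_measure R).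
have /sigma_finiteP[G [GT ndG Goo]] := sigma_finiteT m.
pose g (t : Rn R n.+1) : measurableTypeR R * Rn R n :=
  (thead t, [tuple of behead t]).
have mg : measurable_fun [set: Rn R n.+1] g.
  by apply: measurable_fun_pair;
    [exact: measurable_tnth|exact: measurable_behead].
have gK p : g (Rn_cons p) = p.
  case: p => x t; rewrite /g /Rn_cons /=; congr pair.
  exact: val_inj.
exists (fun k => g @^-1` (F k `*` G k)).
  rewrite -preimage_bigcup (_ : \bigcup_k _ = setT) ?preimage_setT//.
  apply/seteqP; split => // -[x y] _.
  have [i _ Fix] : (\bigcup_i F i) x by rewrite -FT.
  have [j _ Gjy] : (\bigcup_i G i) y by rewrite -GT.
  exists (maxn i j) => //; split => /=.
    by move: Fix; exact/subsetPset/ndF/leq_maxl.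
  by move: Gjy; exact/subsetPset/ndG/leq_maxr.
move=> k; have [mF Fk] := Foo k; have [mG Gk] := Goo k; split.
  by rewrite -[X in measurable X]setTI; apply: mg => //; exact: measurableX.
rewrite /borel_step /pushforward -comp_preimage (_ : g \o _ = id); last first.
  exact/funext.
rewrite preimage_id product_measure1E// lte_mul_pinfty//.
by rewrite ge0_fin_numE.
Qed.

HB.instance Definition _ := Measure_isSigmaFinite.Build _ _ _ borel_step
  borel_step_sigma_finite.
End borel_step.

(* Lebesgue measure on the Borel sets, as the n-fold product of the
   one-dimensional one; see borel_lebesgue_box. *)
Fixpoint borel_lebesgue (R : realType) (n : nat) :
    {sigma_finite_measure set (Rn R n) -> \bar R} :=
  match n with
  | 0%N => @dirac _ (Rn R 0) [tuple] R
  | k.+1 => borel_step (borel_lebesgue R k)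
  end.

Lemma borel_lebesgue_box (R : realType) (n : nat)
    (A : 'I_n -> set (measurableTypeR R)) :
  (forall i, measurable (A i)) ->
  borel_lebesgue R n [set x | forall i, A i (tnth x i)] =
  \prod_(i < n) lebesgue_measure (A i).
Proof.
elim: n A => [|n ih] A mA /=.
  by rewrite big_ord0 diracE mem_set//; case.
rewrite /borel_step /pushforward.
rewrite (_ : _ @^-1` _ =
  A ord0 `*` [set x : Rn R n | forall i, A (lift ord0 i) (tnth x i)]); last first.
  apply/seteqP; split => [[x t] /= H|[x t] /= [H0 H] i].
    by split; [exact: (H ord0)|move=> i; have := H (lift ord0 i); rewrite tnthS].
  case: (unliftP ord0 i) => [j ->|->//].
  by rewrite tnthS; exact: H.
rewrite product_measure1E//; last first.
  rewrite (_ : [set _ | _] = \bigcap_(i in [set: 'I_n])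
    ((fun x : Rn R n => tnth x i) @^-1` A (lift ord0 i))).
    apply: fin_bigcap_measurable => // i _.
    by rewrite -[X in measurable X]setTI; exact: measurable_tnth.
  by apply/seteqP; split => x /= H i; [move=> _; exact: H|exact: H].
rewrite big_ord_recl; congr (_ * _).
exact: (ih (fun i => A (lift ord0 i))).
Qed.

(* R^n with the sigma-algebra of all Lebesgue measurable sets, obtained as the
   Caratheodory sigma-algebra of the outer measure induced by
   borel_lebesgue; its elements and subsets are those of Rn R n. *)
Definition Rn_leb (R : realType) (n : nat) : measurableType _ :=
  caratheodory_type ((borel_lebesgue R n)^*)%mu.

Definition lebesgue (R : realType) (n : nat) :
    {measure set (Rn_leb R n) -> \bar R} :=
  @completed_measure_extension _ _ _ (borel_lebesgue R n).

Definition Rn_ball (R : realType) (n : nat) (x : Rn R n) (r : R) :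
    set (Rn R n) :=
  [set y | (Num.sqrt (\sum_(i < n) (tnth y i - tnth x i) ^+ 2) < r)%R].

(* closed cube with center c, sides of length l parallel to the axes *)
Definition Rn_cube (R : realType) (n : nat) (c : Rn R n) (l : R) :
    set (Rn_leb R n) :=
  [set y : Rn R n | forall i : 'I_n, (`|tnth y i - tnth c i| <= l / 2)%R].

Definition potential (R : realType) (n : nat) (alpha q : R)
    (mu : {measure set (Rn R n) -> \bar R}) (x : Rn R n) : \bar R :=
  (\int[@lebesgue_measure R]_(r in `]0%R, +oo[)
     ((mu (Rn_ball x r) / (r `^ (n%:R - alpha))%:E) `^ q * (r^-1)%:E))
  `^ q^-1.

Definition maximal (R : realType) (n : nat) (alpha : R)
    (mu : {measure set (Rn R n) -> \bar R}) (x : Rn R n) : \bar R :=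
  ereal_sup [set mu (Rn_ball x r) * (r `^ (alpha - n%:R))%:E |
             r in [set r : R | (0 < r)%R]].

Definition weighted (R : realType) (n : nat) (sigma : Rn_leb R n -> R)
    (E : set (Rn_leb R n)) : \bar R :=
  \int[lebesgue R n]_(x in E) (sigma x)%:E.

(* sigma is a weak A_infinity weight with character (Csigma, theta).  In \bar R
   the product of 0 and +oo is 0; this convention only matters when
   lebesgue E = 0, and then weighted sigma E = 0 as well. *)
Definition weak_Ainfty (R : realType) (n : nat) (Csigma theta : R)
    (sigma : Rn_leb R n -> R) : Prop :=
  [/\ (forall x, 0 <= sigma x)%R,
      measurable_fun [set: Rn_leb R n] sigma,
      (0 < Csigma)%R, (0 < theta)%R &
      forall (c : Rn R n) (l : R) (E : set (Rn_leb R n)), (0 < l)%R ->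
        measurable E -> E `<=` Rn_cube c l ->
        weighted sigma E <=
          Csigma%:E * (lebesgue R n E / lebesgue R n (Rn_cube c l)) `^ theta *
          weighted sigma (Rn_cube c (2 * l)%R)].

(* Main.v *)
(* The sublevel set of the maximal function enters only through the density
   bound mu(B(x,r)) <= eps lambda r^(n - alpha).  With s_k = M^-k, the q-th power
   of the potential is comparable to the two-sided sum over k of the terms
   (mu(B(x, s_k)) s_k^(alpha - n))^q.  Decompose Om = {T > lambda} into Whitney
   cubes Q of level k.  For x in Q, the terms with radius larger than s_k are
   dominated by those at a nearby point outside Om, hence add up to at most a
   constant times lambda^q; so if T(x) > tau lambda, the local terms, taken over the
   M-adic cubes that contain x and lie in Q, add up to more than lambda^q.

   Replace the term of an M-adic cube P meeting {M_alpha mu <= eps lambda} by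
   b(P) = t(P)^p, with p = min(q, 1) and t(P) the normalised mu-density of the 3-fold
   dilate of P, and by 0 if P does not meet this set.  Then b is bounded, and since
   alpha > 0 the average of b over the children of P is at most b(P) / 2 for M
   large.  A John-Nirenberg type induction shows that the subset of Q where
   the sum of b exceeds eps^-q has Lebesgue measure at most C exp(- c eps^-q) |Q|.
   The weak A_infinity condition converts this to sigma-measure, and the
   doubles 2Q lie in Om with bounded overlap.  If Om is the whole space, sigma
   has total mass 0 or +oo. *)
Require Import Defs.
From mathcomp Require Import all_boot all_order all_algebra.
From mathcomp Require Import all_classical all_reals all_analysis.
From mathcomp Require Import measurable_realfun.
From mathcomp Require Import zify ring lra.
Set Implicit Arguments.
Unset Strict Implicit.
Unset Printing Implicit Defensive.
Import Order.TTheory GRing.Theory Num.Theory.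
Import numFieldNormedType.Exports.
Local Open Scope classical_set_scope.
Local Open Scope ring_scope.

(** * Integrals over sets that need not be measurable *)

Section nonmeasurable_integral.
Local Open Scope ereal_scope.
Context d (T : measurableType d) (R : realType).
Variable mu : {measure set T -> \bar R}.

(** The integral of a nonnegative function is a supremum over the simple functions below it, hence
    monotone for arbitrary functions. The sets of the theorem, whose measurability is not
    established, are treated this way. *)
Lemma ge0_le_integralT (f g : T -> \bar R) :
  (forall x, 0 <= f x) -> (forall x, f x <= g x) ->
  \int[mu]_x f x <= \int[mu]_x g x.
Proof.
move=> f0 fg; have g0 x : 0 <= g x by exact: le_trans (fg x).
rewrite !ge0_integralTE//; apply: ereal_sup_le => _ [h hf <-].
by exists h => // x; exact: le_trans (fg x).
Qed.

Lemma ge0_le_integral_subset (A B : set T) (f : T -> \bar R) :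
  (forall x, 0 <= f x) -> A `<=` B ->
  \int[mu]_(x in A) f x <= \int[mu]_(x in B) f x.
Proof.
move=> f0 AB; rewrite [leLHS]integral_mkcond [leRHS]integral_mkcond.
apply: ge0_le_integralT => x; first exact: erestrict_ge0.
exact: restrict_lee.
Qed.

Lemma ge0_le_integral_in (A : set T) (f g : T -> \bar R) :
  (forall x, A x -> 0 <= f x) -> (forall x, A x -> f x <= g x) ->
  \int[mu]_(x in A) f x <= \int[mu]_(x in A) g x.
Proof.
move=> f0 fg; rewrite [leLHS]integral_mkcond [leRHS]integral_mkcond.
apply: ge0_le_integralT => x; first exact: erestrict_ge0.
by rewrite !patchE; case: ifPn => //; rewrite inE; exact: fg.
Qed.

Lemma measurable_restrict_funTS (D : set T) (f : T -> \bar R) :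
  measurable D -> measurable_fun setT f -> measurable_fun setT (f \_ D).
Proof.
by move=> mD mf; apply: (measurable_restrictT f mD).1; exact: measurable_funTS.
Qed.

Lemma sum_restrict_count (I : eqType) (s : seq I) (D : I -> set T)
    (f : T -> \bar R) (x : T) : 0 <= f x ->
  \sum_(i <- s) (f \_ (D i)) x = (count (fun i => x \in D i) s)%:R%:E * f x.
Proof.
move=> f0; elim: s => [|i s ih]; first by rewrite big_nil mul0e.
rewrite big_cons ih patchE /=; case: ifPn => _; last by rewrite add0e add0n.
by rewrite natrD EFinD ge0_muleDl ?lee_fin// mul1e.
Qed.

Lemma sum_integral_overlap (I : eqType) (s : seq I) (D : I -> set T)
    (A : set T) (f : T -> \bar R) (N : nat) :
  (forall i, measurable (D i)) -> measurable_fun [set: T] f ->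
  (forall x, 0 <= f x) -> (forall i, D i `<=` A) ->
  (forall x, (count (fun i => x \in D i) s <= N)%N) ->
  \sum_(i <- s) \int[mu]_(x in D i) f x <= N%:R%:E * \int[mu]_(x in A) f x.
Proof.
move=> mD mf f0 DA cN.
under eq_bigr do rewrite integral_mkcond.
rewrite -ge0_integral_sum//; last 2 first.
- by move=> i; exact: measurable_restrict_funTS.
- by move=> i x _; exact: erestrict_ge0.
(* [A] may fail to be measurable, so the constant [N] is pulled out of the integral over the
   measurable union [B] instead. *)
pose B := \big[setU/set0]_(i <- s) D i.
have mB : measurable B by exact: bigsetU_measurable.
have BA : B `<=` A by rewrite /B big_seq; elim/big_ind: _ => // X Y XA YA x [/XA|/YA].
apply: (@le_trans _ _ (\int[mu]_x (N%:R%:E * (f \_ B) x))).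
  apply: ge0_le_integralT => x.
    by apply: sume_ge0 => i _; exact: erestrict_ge0.
  have [xB|xB] := boolP (x \in B).
    rewrite [X in _ * X]patchE xB.
    by rewrite sum_restrict_count// lee_wpmul2r// lee_fin ler_nat.
  rewrite patchE (negbTE xB) mule0 big_seq big1// => i si.
  rewrite patchE memNset// => Dix.
  move/negP : xB; apply; rewrite inE /B (big_rem i)//=; by left.
rewrite ge0_integralZl_EFin//; last 2 first.
- by move=> x _; exact: erestrict_ge0.
- exact: measurable_restrict_funTS.
rewrite -integral_mkcond lee_wpmul2l ?lee_fin//.
exact: ge0_le_integral_subset.
Qed.

(** Passes from an estimate on single Whitney cubes to one on all of [A]: the indicator of [E] is
    majorised by the series of those of the [F i], and the [D i] overlap at most [N] times. *)
Lemma integral_countable_cover (F D : nat -> set T) (E A : set T) (f : T -> \bar R)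
    (N : nat) (eta : R) :
  (forall i, measurable (F i)) -> (forall i, measurable (D i)) ->
  measurable_fun [set: T] f -> (forall x, 0 <= f x) -> (0 <= eta)%R ->
  E `<=` \bigcup_i F i -> (forall i, D i `<=` A) ->
  (forall x m, (count (fun i => x \in D i) (iota 0 m) <= N)%N) ->
  (forall i, \int[mu]_(x in F i) f x <= eta%:E * \int[mu]_(x in D i) f x) ->
  \int[mu]_(x in E) f x <= (eta * N%:R)%:E * \int[mu]_(x in A) f x.
Proof.
move=> mF mD mf f0 eta0 EF DA cN FD.
apply: (@le_trans _ _ (\int[mu]_x \sum_(i <oo) (f \_ (F i)) x)).
  rewrite integral_mkcond; apply: ge0_le_integralT => x; first exact: erestrict_ge0.
  rewrite patchE; case: ifPn => [|_]; last first.
    by apply: nneseries_ge0 => i _ _; exact: erestrict_ge0.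
  rewrite inE => /EF[i _ Fix].
  rewrite (@nneseriesD1 _ _ i)//; last by move=> k _; exact: erestrict_ge0.
  rewrite {1}patchE mem_set// leeDl//.
  by apply: nneseries_ge0 => k _ _; exact: erestrict_ge0.
rewrite integral_nneseries//; last 2 first.
- by move=> i; exact: measurable_restrict_funTS.
- by move=> i x _; exact: erestrict_ge0.
under eq_eseriesr do rewrite -integral_mkcond.
apply: lime_le.
  by apply: is_cvg_nneseries => i _ _; exact: integral_ge0.
apply: nearW => m; rewrite EFinM -muleA.
apply: (@le_trans _ _ (\sum_(0 <= i < m) eta%:E * \int[mu]_(x in D i) f x)).
  by apply: lee_sum => i _; exact: FD.
rewrite -ge0_sume_distrr; last by move=> i _; exact: integral_ge0.
apply: lee_wpmul2l; first by rewrite lee_fin.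
rewrite /index_iota subn0.
exact: sum_integral_overlap.
Qed.

End nonmeasurable_integral.

(** Superlevel sets of a monotone function are intervals. This is applied to the mass of a ball as a
    function of its radius. *)
Lemma emeasurable_nondecreasing (R : realType) (f : R -> \bar R) :
  (forall x y, (x <= y)%R -> (f x <= f y)%E) -> measurable_fun setT f.
Proof.
move=> ndf; apply: (measurability _ (ErealGenOInfty.measurableE R)).
move=> _ [_ [r ->] <-]; rewrite setTI; apply: is_interval_measurable.
move=> x y /= fx fy z /andP[xz zy]; move: fx; rewrite !in_itv/= !andbT => fx.
exact: lt_le_trans fx (ndf _ _ xz).
Qed.

(** * M-adic cubes and a John-Nirenberg estimate *)

(** Overlaps are counted by sending the sets that contain a given point injectively into a finite
    type of relative positions. *)
Lemma count_leq_card (I : eqType) (F : finType) (s : seq I) (P : pred I) (g : I -> F) :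
  uniq s -> (forall i j, P i -> P j -> g i = g j -> i = j) ->
  (count P s <= #|F|)%N.
Proof.
move=> us ginj; rewrite -size_filter -(size_map g).
have ug : uniq [seq g i | i <- s & P i].
  rewrite map_inj_in_uniq ?filter_uniq// => i j.
  by rewrite !mem_filter => /andP[Pi _] /andP[Pj _]; exact: ginj.
by rewrite -(card_uniqP ug) max_card.
Qed.

Lemma ffun_int_ext n (f g : {ffun 'I_n -> int}) :
  (forall i : 'I_n, f i = g i) -> f = g.
Proof. by move=> h; apply/ffunP => i; exact: h. Qed.

Lemma measure_bigsetU_le d (T : measurableType d) (R : realType)
    (mu : {measure set T -> \bar R}) (I : Type) (s : seq I) (F : I -> set T) :
  (forall i, measurable (F i)) ->
  (mu (\big[setU/set0]_(i <- s) F i) <= \sum_(i <- s) mu (F i))%E.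
Proof.
move=> mF; elim: s => [|i s ih]; first by rewrite !big_nil measure0.
rewrite !big_cons; apply: (le_trans (measureU2 _ _ _)) => //.
  by apply: bigsetU_measurable.
by rewrite leeD2l.
Qed.

Section grid.
Context (R : realType) (n M : nat).
Hypothesis M3 : (3 <= M)%N.

Let M0 : (0 : R) < M%:R. Proof. by rewrite ltr0n (leq_trans _ M3). Qed.

Definition side (k : int) : R := M%:R ^ (- k).

Lemma side_gt0 k : 0 < side k.
Proof. exact: exprz_gt0. Qed.

Lemma sideD j k : side (j + k) = side j * side k.
Proof. by rewrite /side opprD expfzDr// gt_eqF. Qed.

Lemma sideN k : side (- k) = (side k)^-1.
Proof. by rewrite /side -invr_expz. Qed.

Lemma side_nat (k : nat) : side (- k%:Z) = M%:R ^+ k.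
Proof. by rewrite /side opprK. Qed.

Lemma sideS k : side k = M%:R * side (k + 1).
Proof. by rewrite sideD -[side 1]invrK -sideN (side_nat 1) expr1 mulrCA divff ?mulr1// gt_eqF. Qed.

Lemma ler_side j k : j <= k -> side k <= side j.
Proof.
move=> jk; rewrite /side; apply: ler_weXz2l; last by rewrite lerN2.
by rewrite ler1n; lia.
Qed.

Lemma side_large (e : R) : exists N : nat, e < side (- N%:Z).
Proof.
exists (Num.bound `|e|); rewrite side_nat -natrX.
apply: (le_lt_trans (ler_norm e)); apply: (lt_trans (archi_boundP (normr_ge0 e))).
by rewrite ltr_nat ltn_expl//; lia.
Qed.

Lemma side_small (e : R) : 0 < e -> exists N : nat, side N%:Z < e.
Proof.
move=> e0; have [N hN] := side_large e^-1; exists N.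
by rewrite -[N%:Z]opprK sideN -[ltRHS]invrK ltf_pV2 ?posrE ?invr_gt0 ?side_gt0.
Qed.

Definition gidx (k : int) (x : Rn R n) : {ffun 'I_n -> int} :=
  [ffun i => Num.floor (tnth x i / side k)].

(* The M-adic cube of level [k] and index [z] is [gbox 0 1 k z]; [gbox 1 2 k z] is its
   union with the neighbouring cubes. *)
Definition gbox (a b : int) (k : int) (z : {ffun 'I_n -> int}) : set (Rn R n) :=
  [set x | forall i : 'I_n, (z i - a)%:~R * side k <= tnth x i < (z i + b)%:~R * side k].

Notation cube := (gbox 0 1).
Notation star := (gbox 1 2).

Lemma gboxP a b k z x :
  gbox a b k z x <-> forall i : 'I_n, z i - a <= gidx k x i < z i + b.
Proof.
have E (i : 'I_n) : (z i - a <= gidx k x i < z i + b) =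
    ((z i - a)%:~R * side k <= tnth x i < (z i + b)%:~R * side k).
  rewrite ffunE floor_ge_int floor_lt_int.
  by rewrite ler_pdivlMr ?side_gt0// ltr_pdivrMr ?side_gt0.
by split=> h i; [rewrite E; exact: h|rewrite -E; exact: h].
Qed.

Lemma cubeP k z x : cube k z x <-> gidx k x = z.
Proof.
rewrite gboxP; split=> [h|-> i]; last by rewrite subr0 lexx ltzD1 lexx.
by apply: ffun_int_ext => i; have := h i; lia.
Qed.

Lemma measurable_box (A : 'I_n -> set (measurableTypeR R)) :
  (forall i, measurable (A i)) ->
  measurable ([set x | forall i, A i (tnth x i)] : set (Rn R n)).
Proof.
move=> mA; rewrite (_ : [set _ | _] = \bigcap_(i in [set: 'I_n])
    ((fun x : Rn R n => tnth x i) @^-1` A i)); last first.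
  by apply/seteqP; split => x /= H i; [move=> _; exact: H|exact: H].
apply: fin_bigcap_measurable => // i _.
by rewrite -[X in measurable X]setTI; exact: measurable_tnth.
Qed.

Lemma gboxE a b k z : gbox a b k z =
  [set x | forall i : 'I_n, `[(z i - a)%:~R * side k, (z i + b)%:~R * side k[%classic (tnth x i)].
Proof.
by apply/seteqP; split => x h i; have := h i; rewrite /= in_itv.
Qed.

Lemma measurable_gbox a b k z : measurable (gbox a b k z).
Proof. rewrite gboxE.
apply: (measurable_box (A := fun i =>
  `[(z i - a)%:~R * side k, (z i + b)%:~R * side k[%classic)) => i.
exact: measurable_itv. Qed.

Lemma borel_lebesgue_cube k z :
  borel_lebesgue R n (cube k z) = (side k ^+ n)%:E.
Proof.
rewrite gboxE (borel_lebesgue_box (A := fun i =>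
  `[(z i - 0)%:~R * side k, (z i + 1)%:~R * side k[%classic)); last first.
  by move=> i; exact: measurable_itv.
rewrite (eq_bigr (fun=> (side k)%:E)) => [|i _]; last first.
  rewrite lebesgue_measure_itv /= lte_fin ltr_pM2r ?side_gt0// ltr_int ltrD2l ltr01.
  by rewrite -EFinD; congr (_%:E); rewrite -mulrBl -intrB; ring.
by rewrite prodEFin prodr_const card_ord.
Qed.

Definition child (z : {ffun 'I_n -> int}) (v : {ffun 'I_n -> 'I_M}) :
  {ffun 'I_n -> int} := [ffun i => z i * M%:Z + (v i)%:Z].

Lemma cube_child k z x : cube k z x -> exists v, cube (k + 1) (child z v) x.
Proof.
move=> hx.
have h (i : 'I_n) : z i * M%:Z <= gidx (k + 1) x i < (z i + 1) * M%:Z.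
  have := hx i; rewrite subr0 sideS ffunE floor_ge_int floor_lt_int.
  rewrite ler_pdivlMr ?side_gt0// ltr_pdivrMr ?side_gt0//.
  by rewrite !intrM !mulrA.
have lt (i : 'I_n) : (`|(gidx (k + 1) x i - z i * M%:Z)%R|%N < M)%N.
  by have := h i; lia.
exists [ffun i => Ordinal (lt i)]; apply/cubeP/ffun_int_ext => i.
have -> : child z [ffun j => Ordinal (lt j)] i =
    z i * M%:Z + `|(gidx (k + 1) x i - z i * M%:Z)%R|%N%:Z by rewrite !ffunE.
by have := h i; lia.
Qed.

Lemma child_gidx k z v x : cube (k + 1) (child z v) x -> gidx k x = z.
Proof.
move=> hx; apply/cubeP => i; have := hx i.
rewrite !ffunE (sideS k) !subr0 !mulrA.
rewrite -[M%:R]/((M%:Z)%:~R) -!intrM => /andP[h1 h2]; apply/andP; split.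
  by apply: le_trans h1; rewrite ler_pM2r ?side_gt0// ler_int; lia.
apply: lt_le_trans h2 _; rewrite ler_pM2r ?side_gt0// ler_int.
by have := ltn_ord (v i); nia.
Qed.

Lemma star_child k z v : star (k + 1) (child z v) `<=` star k z.
Proof.
move=> x hx i; have := hx i; rewrite !ffunE (sideS k) !mulrA.
rewrite -[M%:R]/((M%:Z)%:~R) -!intrM => /andP[h1 h2]; apply/andP; split.
  by apply: le_trans h1; rewrite ler_pM2r ?side_gt0// ler_int; nia.
apply: lt_le_trans h2 _; rewrite ler_pM2r ?side_gt0// ler_int.
by have := ltn_ord (v i); nia.
Qed.

(* Junk unless [star k z x], in which case the entries [gidx k x i - z i + 1] are
   in {0, 1, 2}. *)
Definition offset k (x : Rn R n) (z : {ffun 'I_n -> int}) : {ffun 'I_n -> 'I_3} :=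
  [ffun i => inord `|(gidx k x i - z i + 1)%R|%N].

Lemma offset_inj k x z z' : star k z x -> star k z' x ->
  offset k x z = offset k x z' -> z = z'.
Proof.
move=> /gboxP h /gboxP h' e; apply: ffun_int_ext => i.
have : offset k x z i = offset k x z' i by rewrite e.
move: (h i) (h' i); rewrite !ffunE; move: (Num.floor _) => a hz hz'.
by move/(congr1 val); rewrite /= !inordK; lia.
Qed.

Lemma child_inj z : injective (child z).
Proof.
move=> v v' e; apply/ffunP => i; apply: val_inj => /=.
by have : child z v i = child z v' i; [rewrite e|rewrite !ffunE; lia].
Qed.

(** The dilates of the children lie in the dilate of the parent, and a point is in at most [3 ^ n]
    of them, one for each value of [offset]. *)
Lemma sum_star_child (mu : {measure set (Rn R n) -> \bar R}) k z :
  (\sum_v mu (star (k + 1) (child z v)) <= (3 ^ n)%:R%:E * mu (star k z))%E.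
Proof.
have E j w : mu (star j w) = (\int[mu]_(x in star j w) (cst 1) x)%E.
  by rewrite integral_cst ?mul1e//; exact: measurable_gbox.
rewrite E (eq_bigr _ (fun v _ => E _ (child z v))).
apply: sum_integral_overlap => //.
- by move=> v; exact: measurable_gbox.
- by move=> v; exact: star_child.
move=> x; rewrite -[X in (_ <= X ^ _)%N](card_ord 3) -[X in (_ <= _ ^ X)%N](card_ord n) -card_ffun.
apply: (@count_leq_card _ _ _ _ (fun v => offset (k + 1) x (child z v))).
  exact: index_enum_uniq.
by move=> v v'; rewrite !inE => h h' /(offset_inj h h') /child_inj.
Qed.

(** * Exponential decay of the sets where a sum over nested cubes is large *)

Section excess.
Variables (b : int -> {ffun 'I_n -> int} -> R) (c : R).
Hypotheses (b0 : forall k z, 0 <= b k z) (c0 : 0 <= c).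
Hypothesis cb : forall k z, c * b k z <= 4^-1.
Hypothesis b_child : forall k z,
  \sum_v b (k + 1) (child z v) <= M%:R ^+ n * (b k z / 2).

(* The points of [cube k z] whose partial sum of length [J] of [c * b] along the
   cubes of level [k, k + 1, ..] containing them exceeds [u]. *)
Fixpoint excess (J : nat) (k : int) (z : {ffun 'I_n -> int}) (u : R) : set (Rn R n) :=
  match J with
  | 0%N => if u < 0 then cube k z else set0
  | J'.+1 => \big[setU/set0]_v excess J' (k + 1) (child z v) (u - c * b k z)
  end.

Lemma measurable_excess J k z u : measurable (excess J k z u).
Proof.
elim: J k z u => [|J ih] k z u /=; first by case: ifP => // _; exact: measurable_gbox.
by apply: bigsetU_measurable => v _; exact: ih.
Qed.

Lemma excess_sub_cube J k z u : excess J k z u `<=` cube k z.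
Proof.
elim: J k z u => [|J ih] k z u x /=; first by case: ifP.
rewrite -bigcup_seq => -[v _ /ih hx].
exact/cubeP/(child_gidx hx).
Qed.

Lemma excessS J k z u : excess J k z u `<=` excess J.+1 k z u.
Proof.
elim: J k z u => [|J ih] k z u x.
  rewrite /=; case: ifP => // u0 /cube_child[v hv].
  rewrite -bigcup_seq; exists v; first by rewrite /= mem_index_enum.
  by rewrite ifT// (le_lt_trans _ u0)// gerBl mulr_ge0.
rewrite [excess J.+1 _ _ _]/= -bigcup_seq => -[v vi /ih hx].
by rewrite [excess _ _ _ _]/= -bigcup_seq; exists v.
Qed.

Lemma mem_excess J k z u x : cube k z x ->
  u < c * \sum_(j < J) b (k + j%:Z) (gidx (k + j%:Z) x) -> excess J k z u x.
Proof.
elim: J k z u => [|J ih] k z u hx; first by rewrite big_ord0 mulr0 /= => ->.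
rewrite big_ord_recl /= addr0 ((cubeP _ _ _).1 hx) mulrDr => hu.
have [v hv] := cube_child hx.
rewrite -bigcup_seq; exists v; first by rewrite /= mem_index_enum.
apply: ih => //; rewrite ltrBlDl; apply: lt_le_trans hu _; rewrite lerD2l ler_wpM2l//.
by apply: ler_sum => j _; rewrite /bump /= -addrA -PoszD add1n.
Qed.

(* This makes [1 + 4 * y] a supersolution of the recursion defining [excess]. *)
Lemma expR_le_excess (y : R) : 0 <= y <= 4^-1 -> expR y * (1 + 2 * y) <= 1 + 4 * y.
Proof.
move=> /andP[y0 y4]; have e1 : expR y * (1 - y) <= 1.
  by rewrite -ler_pdivlMl ?expR_gt0// mulr1 -expRN; exact: expR_ge1Dx.
have e0 := expR_gt0 y; nra.
Qed.

(** Induction on [J] for all thresholds at once. Passing to the children lowers the threshold by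
    [y = c * b k z], which costs [expR y]; averaging over them turns [1 + 4 * y] into at most
    [1 + 2 * y], and [expR_le_excess] balances the two. *)
Lemma borel_lebesgue_excess J k z u :
  (borel_lebesgue R n (excess J k z u) <=
   (expR (- u) * (1 + 4 * (c * b k z)) * side k ^+ n)%:E)%E.
Proof.
have cb0 k' z' : 0 <= c * b k' z' by rewrite mulr_ge0.
have s0 k' := ltW (side_gt0 k').
have ge k' z' u' : 0 <= expR (- u') * (1 + 4 * (c * b k' z')) * side k' ^+ n.
  by rewrite !mulr_ge0 ?expR_ge0 ?exprn_ge0// addr_ge0// mulr_ge0.
elim: J k z u => [|J ih] k z u /=.
  case: ifPn => [u0|_]; last by rewrite measure0 lee_fin.
  rewrite borel_lebesgue_cube lee_fin ler_peMl ?exprn_ge0//.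
  rewrite mulr_ege1//; first by rewrite -expR0 ler_expR; lra.
  by rewrite lerDl mulr_ge0.
apply: (@le_trans _ _ (\sum_v borel_lebesgue R n
    (excess J (k + 1) (child z v) (u - c * b k z)))%E).
  by apply: measure_bigsetU_le => v; exact: measurable_excess.
apply: (le_trans (lee_sum _ (fun v _ => ih (k + 1) (child z v) (u - c * b k z)))).
rewrite sumEFin lee_fin -mulr_suml -mulr_sumr big_split /= -mulr_sumr -mulr_sumr.
rewrite sumr_const card_ffun !card_ord (sideS k) exprMn opprB addrC expRD natrX.
set y := c * b k z; set X := \sum_v _; set t := side _ ^+ n; set m := M%:R ^+ n.
have t0 : 0 <= t by exact: exprn_ge0.
have ySy : m + 4 * (c * X) <= m * (1 + 2 * y).
  have := ler_wpM2l c0 (b_child k z); rewrite -/X -/m /y; lra.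
have y4 : expR y * (1 + 2 * y) <= 1 + 4 * y by apply: expR_le_excess; rewrite cb0 cb.
have m0 : 0 <= m by exact: exprn_ge0.
rewrite [leLHS](_ : _ = expR (- u) * t * (expR y * (m + 4 * (c * X)))); last by ring.
rewrite [leRHS](_ : _ = expR (- u) * t * (m * (1 + 4 * y))); last by ring.
rewrite ler_wpM2l ?mulr_ge0 ?expR_ge0//.
apply: le_trans (ler_wpM2l (expR_ge0 y) ySy) _.
by rewrite mulrCA ler_wpM2l.
Qed.

Lemma measurable_bigcup_excess k z u : measurable (\bigcup_J excess J k z u).
Proof. by apply: bigcupT_measurable => J; exact: measurable_excess. Qed.

(** The previous bound is uniform in [J] and the sets increase with [J], so continuity from below
    applies; [cb] bounds [1 + 4 * (c * b k z)] by 2. *)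
Lemma borel_lebesgue_bigcup_excess k z u :
  (borel_lebesgue R n (\bigcup_J excess J k z u) <=
   (2 * expR (- u) * side k ^+ n)%:E)%E.
Proof.
have nd : nondecreasing_seq (fun J => excess J k z u).
  by apply/nondecreasing_seqP => J; apply/subsetPset; exact: excessS.
have cvgE := nondecreasing_cvg_mu (mu := borel_lebesgue R n)
  (fun J => measurable_excess J k z u) (measurable_bigcup_excess k z u) nd.
rewrite -(cvg_lim _ cvgE)//; apply: lime_le.
  by apply/cvg_ex; eexists; exact: cvgE.
apply: nearW => J; apply: (le_trans (borel_lebesgue_excess _ _ _ _)).
rewrite lee_fin ler_wpM2r ?exprn_ge0 ?(ltW (side_gt0 _))//.
rewrite mulrC ler_wpM2r ?expR_ge0//; have := cb k z; lra.
Qed.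

End excess.

End grid.

(** * Discretisation of the potential *)

Section radial.
Context (R : realType) (n M : nat) (alpha q : R).
Variable mu : {measure set (Rn R n) -> \bar R}.
Hypotheses (M3 : (3 <= M)%N) (halpha : alpha < n%:R) (hq : 0 < q).

Notation side := (side R M).

Let M0 : (0 : R) < M%:R. Proof. by rewrite ltr0n (leq_trans _ M3). Qed.

Lemma measurable_Rn_ball x r : measurable (@Rn_ball R n x r).
Proof.
have mf : measurable_fun [set: Rn R n]
    (fun y : Rn R n => Num.sqrt (\sum_(i < n) (tnth y i - tnth x i) ^+ 2)).
  have ms : measurable_fun [set: R] (@Num.sqrt R).
    by apply: continuous_measurable_fun; exact: sqrt_continuous.
  apply: (measurableT_comp ms).
  apply: measurable_sum => i; apply: measurable_funX; apply: measurable_funB => //.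
  exact: measurable_tnth.
rewrite /Rn_ball -[X in measurable X]setTI.
have := mf measurableT `]-oo, r[%classic (measurable_itv _).
by congr (measurable (_ `&` _)); apply/seteqP; split => y /=; rewrite in_itv.
Qed.

Lemma le_mu_ball x r y t : Rn_ball x r `<=` Rn_ball y t ->
  (mu (Rn_ball x r) <= mu (Rn_ball y t))%E.
Proof. by move=> h; apply: le_measure; rewrite ?inE//; exact: measurable_Rn_ball. Qed.

Lemma Rn_ball_le (x : Rn R n) r t : r <= t -> Rn_ball x r `<=` Rn_ball x t.
Proof. by move=> rt y /= /lt_le_trans; apply. Qed.

(** Mass and radius are separate arguments, so that each can be enlarged or reduced on its own. *)
Definition radial_weight (m : \bar R) (r : R) : \bar R :=
  ((m * (r `^ (alpha - n%:R))%:E) `^ q)%E.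

Lemma radial_weight_ge0 m r : (0 <= radial_weight m r)%E.
Proof. exact: poweR_ge0. Qed.

Lemma le_radial_weight m m' r r' : (0 <= m)%E -> (m <= m')%E -> 0 < r' -> r' <= r ->
  (radial_weight m r <= radial_weight m' r')%E.
Proof.
move=> m0 mm' r0 rr'.
have e0 : (0 <= m * (r `^ (alpha - n%:R))%:E)%E by rewrite mule_ge0// lee_fin powR_ge0.
have e1 : (m * (r `^ (alpha - n%:R))%:E <= m' * (r' `^ (alpha - n%:R))%:E)%E.
  rewrite lee_pmul ?lee_fin ?powR_ge0// -opprB !powRN.
  rewrite lef_pV2 ?posrE ?powR_gt0//; last exact: lt_le_trans rr'.
  by rewrite ge0_ler_powR ?nnegrE ?subr_ge0 ?(ltW halpha)// ?(ltW r0)// (le_trans (ltW r0)).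
apply: gt0_ler_poweR => //; first exact: ltW.
  by rewrite in_itv/= leey andbT.
by rewrite in_itv/= leey andbT (le_trans e0).
Qed.

Lemma radial_weight_scale m c r : (0 <= m)%E -> 0 < c -> 0 < r ->
  radial_weight m (c * r) = ((c `^ ((n%:R - alpha) * q))^-1%:E * radial_weight m r)%E.
Proof.
move=> m0 c0 r0; rewrite /radial_weight powRM ?(ltW c0) ?(ltW r0)//.
rewrite EFinM muleCA [LHS]poweRM ?mule_ge0 ?lee_fin ?powR_ge0//.
by rewrite poweR_EFin -powRrM -powRN -mulNr opprB.
Qed.

Definition annulus_term (k : int) (x : Rn R n) : \bar R :=
  radial_weight (mu (Rn_ball x (side k))) (side k).

Lemma annulus_term_ge0 k x : (0 <= annulus_term k x)%E.
Proof. exact: radial_weight_ge0. Qed.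

Definition radial (x : Rn R n) (r : R) : \bar R :=
  ((mu (Rn_ball x r) / (r `^ (n%:R - alpha))%:E) `^ q * (r^-1)%:E)%E.

Lemma radialE x r : 0 < r -> radial x r = (radial_weight (mu (Rn_ball x r)) r * (r^-1)%:E)%E.
Proof.
move=> r0; rewrite /radial inver gt_eqF ?powR_gt0//.
by rewrite -powRN opprB.
Qed.

Lemma radial_ge0 x r : 0 < r -> (0 <= radial x r)%E.
Proof.
by move=> r0; rewrite radialE// mule_ge0 ?radial_weight_ge0// lee_fin invr_ge0 ltW.
Qed.

(** The factor by which [radial_weight] changes when the radius changes by the factor [M]. *)
Definition shift_cost : R := M%:R `^ ((n%:R - alpha) * q).

Lemma shift_cost_gt0 : 0 < shift_cost. Proof. exact: powR_gt0. Qed.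

(** The mass is taken at the outer radius of the shell, the decreasing factors at the inner one. In
    [radial_ge] the roles are exchanged. *)
Lemma radial_le k x r : side (k + 1) <= r -> r <= side k ->
  (radial x r <= (shift_cost * M%:R / side k)%:E * annulus_term k x)%E.
Proof.
move=> kr rk; have s0 := side_gt0 R M3 (k + 1).
have sE : side (k + 1) = M%:R^-1 * side k.
  by rewrite (sideS R M3 k) mulKf// gt_eqF.
have r0 := lt_le_trans s0 kr.
rewrite radialE// -mulrA EFinM muleAC; apply: lee_pmul; rewrite ?radial_weight_ge0//.
- by rewrite lee_fin invr_ge0 ltW.
- have <- : radial_weight (mu (Rn_ball x (side k))) (side (k + 1)) =
      (shift_cost%:E * annulus_term k x)%E.
    rewrite sE radial_weight_scale ?invr_gt0 ?side_gt0// /shift_cost.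
    by rewrite -[M%:R^-1]powR_inv1 ?(ltW M0)// -powRrM mulN1r powRN invrK.
  by apply: le_radial_weight => //; apply: le_mu_ball; exact: Rn_ball_le.
- rewrite lee_fin -[leRHS]invrK invf_div lef_pV2 ?posrE//; last first.
    by rewrite divr_gt0 ?side_gt0.
  by rewrite mulrC -sE.
Qed.

Lemma radial_ge k x r : side k <= r -> r <= side (k - 1) ->
  ((shift_cost * side (k - 1))^-1%:E * annulus_term k x <= radial x r)%E.
Proof.
move=> kr rk; have s0 := side_gt0 R M3 k.
have sE : side (k - 1) = M%:R * side k by rewrite (sideS R M3 (k - 1)) subrK.
have r0 := lt_le_trans s0 kr.
rewrite radialE// invfM mulrC EFinM -muleA muleC; apply: lee_pmul.
- by rewrite mule_ge0 ?radial_weight_ge0// lee_fin invr_ge0 ltW// shift_cost_gt0.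
- by rewrite lee_fin invr_ge0 ltW// side_gt0.
- rewrite -radial_weight_scale//.
  by apply: le_radial_weight => //; [apply: le_mu_ball; exact: Rn_ball_le|rewrite -sE].
- by rewrite lee_fin lef_pV2 ?posrE// side_gt0.
Qed.

Lemma measurable_radial x : measurable_fun (`]0, +oo[%classic : set (measurableTypeR R)) (radial x).
Proof.
apply: (eq_measurable_fun (fun r => radial_weight (mu (Rn_ball x r)) r * (r `^ (-1))%:E)%E).
  move=> r; rewrite inE /= in_itv/= andbT => r0.
  by rewrite radialE// powR_inv1// ltW.
apply: emeasurable_funM; last first.
  apply/measurable_EFinP; apply: measurable_funTS.
  apply: measurable_powR.
apply: measurable_funTS.
apply: (measurableT_comp (measurable_poweR q)).
apply: emeasurable_funM.
  apply: emeasurable_nondecreasing => r t rt.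
  by apply: le_mu_ball; exact: Rn_ball_le.
by apply/measurable_EFinP; apply: measurable_powR.
Qed.

Definition shell (j k : int) : set (measurableTypeR R) := `[side k, side j[%classic.

Lemma shell_sub j k : shell j k `<=` `]0, +oo[%classic.
Proof.
move=> r; rewrite /shell /= !in_itv/= andbT => /andP[+ _].
exact: lt_le_trans (side_gt0 _ _ _).
Qed.

Lemma measurable_shell j k : measurable (shell j k).
Proof. exact: measurable_itv. Qed.

Lemma integral_cst_shell j k (c : \bar R) : j <= k ->
  (\int[@lebesgue_measure R]_(r in shell j k) c = c * (side j - side k)%:E)%E.
Proof.
move=> jk; rewrite integral_cst; last exact: measurable_shell.
rewrite [X in (c * X)%E](lebesgue_measure_itv `[side k, side j[) /= lte_fin; case: ltP => // h.
have -> : side j = side k by apply/le_anti; rewrite h ler_side.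
by rewrite subrr.
Qed.

Lemma integral_shell_sum x k N :
  (\int[@lebesgue_measure R]_(r in shell k (k + N%:Z)) radial x r =
   \sum_(j < N) \int[@lebesgue_measure R]_(r in shell (k + j%:Z) (k + j%:Z + 1)) radial x r)%E.
Proof.
elim: N => [|N ih].
  by rewrite big_ord0 addr0 /shell set_itvco0 ?integral_set0.
have h1 : side (k + N.+1%:Z) <= side (k + N%:Z) by apply: ler_side => //; lia.
have h2 : side (k + N%:Z) <= side k by apply: ler_side => //; lia.
rewrite big_ord_recr /= -ih /shell.
rewrite (@itv_bndbnd_setU _ _ _ (BLeft (side (k + N%:Z))))//.
rewrite ge0_integral_setU//.
- by rewrite addeC (_ : k + N.+1%:Z = k + N%:Z + 1)//; lia.
- apply: measurable_funS (measurable_radial x) => //.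
  by move=> r [] /shell_sub.
- by move=> r [] /shell_sub; rewrite /= in_itv/= andbT; exact: radial_ge0.
- rewrite disj_set2E; apply/eqP; rewrite -subset0 => r /= [].
  by rewrite !in_itv/= => /andP[_ h] /andP[h' _]; move: h; rewrite ltNge h'.
Qed.

Definition energy (x : Rn R n) : \bar R :=
  (\int[@lebesgue_measure R]_(r in `]0%R, +oo[) radial x r)%E.

Lemma integral_shell_le x k :
  (\int[@lebesgue_measure R]_(r in shell k (k + 1)) radial x r <=
   (shift_cost * M%:R)%:E * annulus_term k x)%E.
Proof.
have s0 := side_gt0 R M3; have L0 := shift_cost_gt0.
apply: (@le_trans _ _ (\int[@lebesgue_measure R]_(r in shell k (k + 1))
    ((shift_cost * M%:R / side k)%:E * annulus_term k x))%E).
  apply: ge0_le_integral_in => r rk.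
    by apply: radial_ge0; have := shell_sub rk; rewrite /= in_itv/= andbT.
  by move: rk; rewrite /shell/= in_itv/= => /andP[h /ltW]; exact: radial_le.
rewrite integral_cst_shell; last by lia.
rewrite muleAC -EFinM lee_wpmul2r ?annulus_term_ge0// lee_fin.
rewrite -[leLHS]mulrA -[leRHS]mulr1 ler_wpM2l ?mulr_ge0 ?(ltW shift_cost_gt0) ?(ltW M0)//.
rewrite mulrC ler_pdivrMr ?s0// mul1r gerBl; exact: ltW.
Qed.

Lemma integral_shell_ge x k :
  (annulus_term k x <=
   (2 * shift_cost)%:E * \int[@lebesgue_measure R]_(r in shell (k - 1) k) radial x r)%E.
Proof.
have s0 := side_gt0 R M3; have L0 := shift_cost_gt0.
have : ((shift_cost * side (k - 1))^-1%:E * annulus_term k x * (side (k - 1) - side k)%:E <=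
    \int[@lebesgue_measure R]_(r in shell (k - 1) k) radial x r)%E.
  rewrite -integral_cst_shell; last by lia.
  apply: ge0_le_integral_in => r; rewrite /shell/= in_itv/= => /andP[h /ltW h'].
    by rewrite mule_ge0 ?annulus_term_ge0// lee_fin invr_ge0 mulr_ge0 ?ltW.
  exact: radial_ge.
rewrite muleAC -EFinM => h.
have h2 : (0%R <= (2 * shift_cost)%:E)%E by rewrite lee_fin mulr_ge0 ?ltW.
apply: le_trans (lee_wpmul2l h2 h); rewrite muleA -EFinM.
rewrite -[leLHS]mul1e lee_wpmul2r ?annulus_term_ge0// lee_fin.
have sE : side (k - 1) = M%:R * side k by rewrite (sideS R M3 (k - 1)) subrK.
have M3' : 3 <= M%:R :> R by rewrite ler_nat.
(* The shell has length [1 - M^-1] times [side (k - 1)]. Since [M >= 3], twice this fraction is at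
   least 1, whence the factor 2 in the statement. *)
have -> : 2 * shift_cost * ((shift_cost * side (k - 1))^-1 * (side (k - 1) - side k)) =
    2 * (1 - M%:R^-1).
  rewrite sE; field.
  by rewrite !gt_eqF.
have : M%:R^-1 <= 2^-1 :> R by rewrite lef_pV2 ?posrE//; lra.
lra.
Qed.

Lemma sum_annulus_le_energy x k N :
  (\sum_(j < N) annulus_term (k + j%:Z) x <= (2 * shift_cost)%:E * energy x)%E.
Proof.
(* The term of level [k + j] is charged to the shell just outside its radius, so the union of the
   shells starts at level [k - 1]. *)
apply: (@le_trans _ _ ((2 * shift_cost)%:E * \int[@lebesgue_measure R]_(r in
    shell (k - 1) (k - 1 + N%:Z)) radial x r)%E).
  rewrite integral_shell_sum ge0_sume_distrr; last first.
    move=> j _; apply: integral_ge0 => r /shell_sub.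
    by rewrite /= in_itv/= andbT; exact: radial_ge0.
  apply: lee_sum => j _; apply: le_trans (integral_shell_ge _ _) _.
  by rewrite (_ : k - 1 + j%:Z = k + j%:Z - 1) ?subrK//; lia.
rewrite lee_wpmul2l ?lee_fin ?mulr_ge0 ?(ltW shift_cost_gt0)//.
apply: ge0_subset_integral => //.
- exact: measurable_shell.
- exact: measurable_radial.
- by move=> r; rewrite /= in_itv/= andbT; exact: radial_ge0.
- exact: shell_sub.
Qed.

(** Monotone convergence along shells exhausting the half-line, valid also for infinite energy. The
    window of levels is centred at [k] so that it splits into [N] levels coarser than [k] and [N]
    levels from [k] on. *)
Lemma energy_gt_sum_annulus x k (e : R) : (e%:E < energy x)%E ->
  exists N, (e%:E < (shift_cost * M%:R)%:E * \sum_(j < N + N) annulus_term (k - N%:Z + j%:Z) x)%E.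
Proof.
move=> ee.
have [N hN] : exists N, (e%:E < \int[@lebesgue_measure R]_(r in
    shell (k - N%:Z) (k + N%:Z)) radial x r)%E.
  apply: contrapT => /forallNP h; move: ee; apply/negP; rewrite -leNgt.
  pose F N := shell (k - N%:Z) (k + N%:Z).
  have FU : \bigcup_N F N = `]0%R, +oo[%classic.
    apply/seteqP; split => r; first by case=> N _ /shell_sub.
    rewrite /= in_itv/= andbT => r0; have s0 := side_gt0 R M3 k.
    have [N1 h1] := side_small M3 (divr_gt0 r0 s0).
    have [N2 h2] := side_large M3 (r / side k).
    exists (maxn N1 N2) => //; rewrite /F /shell /= in_itv/= !sideD//; apply/andP; split.
      rewrite -ler_pdivlMl// mulrC; apply: le_trans (ltW h1).
      by apply: ler_side => //; lia.
    rewrite -ltr_pdivrMl// mulrC; apply: (lt_le_trans h2).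
    by apply: ler_side => //; lia.
  have ndF : nondecreasing_seq F.
    apply/nondecreasing_seqP => N; apply/subsetPset => r.
    rewrite /F /shell /= !in_itv/= => /andP[r1 r2]; apply/andP; split.
      by apply: le_trans r1; apply: ler_side => //; lia.
    by apply: lt_le_trans r2 _; apply: ler_side => //; lia.
  have mF N : measurable (F N) by exact: measurable_shell.
  have mfF N : measurable_fun (F N) (radial x).
    by apply: measurable_funS (measurable_radial x) => //; exact: shell_sub.
  have f0F N r : F N r -> (0 <= radial x r)%E.
    by move=> /shell_sub; rewrite /= in_itv/= andbT; exact: radial_ge0.
  have cv := ge0_nondecreasing_set_cvg_integral (mu := @lebesgue_measure R) ndF mF mfF f0F.
  rewrite /energy -FU -(cvg_lim _ cv)//; apply: lime_le.
    by apply/cvg_ex; eexists; exact: cv.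
  by apply: nearW => N; rewrite leNgt; apply/negP; exact: h.
exists N; apply: (lt_le_trans hN).
have {1}-> : k + N%:Z = k - N%:Z + (N + N)%N%:Z by lia.
rewrite integral_shell_sum ge0_sume_distrr => [|j _]; last exact: annulus_term_ge0.
by apply: lee_sum => j _; exact: integral_shell_le.
Qed.

End radial.

(** * Density of the measure on M-adic cubes *)

(** The Euclidean distance is at most [sqrt n] times the sup distance; the cruder factor [n] keeps
    roots out of the constants. *)
Lemma sup_le_Rn_ball (R : realType) (n : nat) (x y : Rn R n) (d r : R) :
  0 <= d -> (forall i, `|tnth y i - tnth x i| <= d) -> n%:R * d < r -> Rn_ball x r y.
Proof.
move=> d0 h; apply: le_lt_trans.
have nd : 0 <= n%:R * d by rewrite mulr_ge0.
rewrite -(ger0_norm nd) -sqrtr_sqr ler_sqrt ?sqr_ge0//.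
apply: (@le_trans _ _ (\sum_(i < n) d ^+ 2)).
  by apply: ler_sum => i _; rewrite -real_normK ?num_real// lerXn2r ?nnegrE.
rewrite sumr_const card_ord exprMn -[leLHS]mulr_natl ler_wpM2r ?sqr_ge0//.
by rewrite -natrX ler_nat; case: (n) => // m; rewrite -{1}(expn1 m.+1) leq_pexp2l.
Qed.

Lemma Rn_ball_sup_lt (R : realType) (n : nat) (x y : Rn R n) (r : R) (i : 'I_n) :
  Rn_ball x r y -> `|tnth y i - tnth x i| < r.
Proof.
apply: le_lt_trans; rewrite -sqrtr_sqr ler_wsqrtr//.
rewrite (bigD1 i)//= lerDl; apply: sumr_ge0 => j _; exact: sqr_ge0.
Qed.

(* Stands in for Jensen's inequality when averaging [t `^ p] over children. *)
Lemma powR_le_affine (R : realType) (t d p : R) : 0 <= t -> 0 < d -> 0 < p <= 1 ->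
  t `^ p <= d `^ p + d `^ (p - 1) * t.
Proof.
move=> t0 d0 /andP[p0 p1]; have [td|dt] := leP t d.
  apply: (@le_trans _ _ (d `^ p)); last by rewrite lerDl mulr_ge0 ?powR_ge0.
  by rewrite ge0_ler_powR ?nnegrE ?(ltW p0) ?(ltW d0).
have t0' := lt_trans d0 dt.
apply: (@le_trans _ _ (d `^ (p - 1) * t)); last by rewrite lerDr powR_ge0.
rewrite -(mulr_powRB1 t0 p0) mulrC ler_wpM2r// -opprB !powRN.
rewrite lef_pV2 ?posrE ?powR_gt0//.
by rewrite ge0_ler_powR ?nnegrE ?subr_ge0 ?(ltW d0) ?(ltW dt).
Qed.

Section density.
Context (R : realType) (n M : nat) (alpha q p rho e : R).
Variables (mu : {measure set (Rn R n) -> \bar R}) (G : set (Rn R n)).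
Hypotheses (M3 : (3 <= M)%N) (n1 : (1 <= n)%N).
Hypotheses (halpha : alpha < n%:R) (hq : 0 < q) (hp : 0 < p <= 1) (pq : p <= q).
Hypotheses (e0 : 0 < e) (rho0 : 0 < rho) (hrho : rho `^ p <= 4^-1).
Hypothesis hM : (3 ^ n)%:R <= rho * M%:R `^ alpha.
Hypothesis hG : forall x r, G x -> 0 < r ->
  (mu (Rn_ball x r) <= (e * r `^ (n%:R - alpha))%:E)%E.

Notation side := (side R M).
Notation cube := (gbox M 0 1).
Notation star := (gbox M 1 2).

Let s0 := side_gt0 R M3.
Let M0 : (0 : R) < M%:R. Proof. by rewrite ltr0n (leq_trans _ M3). Qed.

(** Division by [e] makes the bound [density_bound] independent of [e]. The default value of [fine]
    does no harm: the mass is finite for cubes that meet [G] and for their children. *)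
Definition density (k : int) (z : {ffun 'I_n -> int}) : R :=
  fine (mu (star k z)) * side k `^ (alpha - n%:R) / e.

(** Comes from the ball of radius [3 * n%:R * side k] about a point of [G] in the cube, which
    contains the dilate. *)
Definition density_bound : R := (3 * n%:R) `^ (n%:R - alpha).

Lemma density_ge0 k z : 0 <= density k z.
Proof. by rewrite !mulr_ge0 ?powR_ge0 ?invr_ge0 ?(ltW e0)// fine_ge0. Qed.

Lemma cube_star_sup k z (x y : Rn R n) (i : 'I_n) : cube k z x -> star k z y ->
  `|tnth y i - tnth x i| <= 2 * side k.
Proof.
move=> /(_ i) + /(_ i); rewrite subr0 !intrD !intrN mulrDl mulrBl mulrDl mul1r.
move=> /andP[h1 h2] /andP[h3 h4]; rewrite ler_norml; have := s0 k.
by move=> ?; apply/andP; split; lra.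
Qed.

Lemma mu_star_le k z : cube k z `&` G !=set0 ->
  (mu (star k z) <= (e * (3 * n%:R * side k) `^ (n%:R - alpha))%:E)%E.
Proof.
case=> x [xz xG]; have n0 : (0 : R) < n%:R by rewrite ltr0n.
apply: le_trans (hG xG _); last by rewrite !mulr_gt0.
apply: le_measure; rewrite ?inE; [exact: measurable_gbox|exact: measurable_Rn_ball|].
move=> y yz; apply: (@sup_le_Rn_ball _ _ _ _ (2 * side k)).
- by rewrite mulr_ge0 ?(ltW (s0 k)).
- by move=> i; exact: cube_star_sup.
- by rewrite mulrCA -mulrA ltr_pM2r ?mulr_gt0//; lra.
Qed.

Lemma mu_star_fin k z : cube k z `&` G !=set0 -> mu (star k z) \is a fin_num.
Proof.
by move=> /mu_star_le h; rewrite ge0_fin_numE// (le_lt_trans h)// ltry.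
Qed.

Lemma density_le k z : cube k z `&` G !=set0 -> density k z <= density_bound.
Proof.
move=> zG; have n0 : (0 : R) < n%:R by rewrite ltr0n.
have := mu_star_le zG; rewrite -[mu _]fineK ?mu_star_fin// lee_fin => h.
rewrite /density ler_pdivrMr// -opprB powRN ler_pdivrMr ?powR_gt0//.
apply: (le_trans h); rewrite powRM ?mulr_ge0// ?(ltW (s0 k))//.
by rewrite mulrA [e * _]mulrC.
Qed.

(* Cutting off by the cubes that meet [G], rather than by [G] itself, keeps the sets
   [excess] measurable although [G] is not known to be. *)
Definition cube_energy (k : int) (z : {ffun 'I_n -> int}) : R :=
  if `[< cube k z `&` G !=set0 >] then density k z `^ p else 0.

Lemma cube_energy_ge0 k z : 0 <= cube_energy k z.
Proof. by rewrite /cube_energy; case: ifP => // _; exact: powR_ge0. Qed.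

Lemma cube_energy_le k z : cube_energy k z <= density_bound `^ p.
Proof.
rewrite /cube_energy; case: ifP => [/asboolP zG|_]; last exact: powR_ge0.
have /andP[p0 _] := hp.
by rewrite ge0_ler_powR ?nnegrE ?density_ge0 ?powR_ge0 ?(ltW p0) ?density_le.
Qed.

(** The overlap costs [3 ^ n] and the normalisation at the smaller scale [M^(n - alpha)]; by [hM]
    their product is at most [rho * M ^ n]. *)
Lemma sum_density_child k z : cube k z `&` G !=set0 ->
  \sum_v density (k + 1) (child (M := M) z v) <= M%:R ^+ n * rho * density k z.
Proof.
move=> zG; have fin := mu_star_fin zG.
have finc v : mu (star (k + 1) (child (M := M) z v)) \is a fin_num.
  rewrite ge0_fin_numE//; apply: le_lt_trans (_ : mu (star k z) < +oo)%E.
    by apply: le_measure; rewrite ?inE; [exact: measurable_gbox..|exact: star_child].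
  by rewrite -ge0_fin_numE.
have h : \sum_v fine (mu (star (k + 1) (child (M := M) z v))) <=
    (3 ^ n)%:R * fine (mu (star k z)).
  rewrite -lee_fin EFinM fineK// -sumEFin.
  rewrite (eq_bigr (fun v => mu (star (k + 1) (child (M := M) z v)))).
    exact: sum_star_child.
  by move=> v _; rewrite fineK.
rewrite /density -!mulr_suml.
have -> : side (k + 1) `^ (alpha - n%:R) = M%:R `^ (n%:R - alpha) * side k `^ (alpha - n%:R).
  rewrite (sideS R M3 k) powRM ?(ltW M0) ?(ltW (s0 _))//.
  by rewrite -[n%:R - alpha]opprB powRN mulKf// gt_eqF ?powR_gt0.
rewrite !mulrA ler_wpM2r ?invr_ge0 ?(ltW e0)// ler_wpM2r ?powR_ge0//.
apply: le_trans (ler_wpM2r (powR_ge0 _ _) h) _.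
rewrite mulrAC ler_wpM2r ?fine_ge0//.
apply: le_trans (ler_wpM2r (powR_ge0 _ _) hM) _.
rewrite -mulrA -powRD; last by apply/implyP => _; rewrite gt_eqF.
by rewrite addrCA subrr addr0 powR_mulrn ?(ltW M0)// mulrC.
Qed.

(** If the cube misses [G], so do its children and both sides vanish. Otherwise the children have
    average density at most [rho * density k z], and the smallness of [rho] survives the power
    [p]. *)
Lemma cube_energy_child k z :
  \sum_v cube_energy (k + 1) (child (M := M) z v) <= M%:R ^+ n * (cube_energy k z / 2).
Proof.
have /andP[p0 p1] := hp.
rewrite {2}/cube_energy; case: ifPn => [/asboolP zG|/asboolP zG]; last first.
  rewrite mul0r mulr0 big1// => v _; rewrite /cube_energy ifF//.
  apply/asboolP => -[x [xv xG]]; apply: zG; exists x; split => //.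
  by apply/cubeP => //; exact: child_gidx xv.
apply: (@le_trans _ _ (\sum_v density (k + 1) (child (M := M) z v) `^ p)).
  apply: ler_sum => v _; rewrite /cube_energy; case: ifP => // _; exact: powR_ge0.
have hs := sum_density_child zG.
have [t0|t0] := eqVneq (density k z) 0.
  rewrite t0 powR0 ?gt_eqF// mul0r mulr0; rewrite t0 mulr0 in hs.
  have hs0 : \sum_v density (k + 1) (child (M := M) z v) = 0.
    by apply/le_anti; rewrite hs sumr_ge0// => v _; exact: density_ge0.
  rewrite big1// => v _; rewrite (psumr_eq0P _ hs0) ?powR0 ?gt_eqF// => w _.
  exact: density_ge0.
have t0' : 0 < density k z by rewrite lt0r t0 density_ge0.
(* As [d] bounds the average density of the children, the affine majorant touching at [d] averages
   to at most [2 * d ^ p], which [rho ^ p <= 1/4] makes at most half of [density k z ^ p]. Zero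
   density was treated apart because [d] must be positive. *)
set d := rho * density k z; have d0 : 0 < d by rewrite mulr_gt0.
apply: (@le_trans _ _ (\sum_(v : {ffun 'I_n -> 'I_M})
    (d `^ p + d `^ (p - 1) * density (k + 1) (child z v)))).
  by apply: ler_sum => v _; apply: powR_le_affine => //; exact: density_ge0.
rewrite big_split /= -mulr_sumr sumr_const card_ffun !card_ord -[X in X + _]mulr_natl natrX.
have dd : d `^ (p - 1) * (M%:R ^+ n * rho * density k z) = M%:R ^+ n * d `^ p.
  by rewrite -(mulr_powRB1 (ltW d0) p0) /d; ring.
apply: (@le_trans _ _ (M%:R ^+ n * d `^ p + M%:R ^+ n * d `^ p)).
  by rewrite lerD2l -dd ler_wpM2l ?powR_ge0.
rewrite -mulrDr ler_wpM2l ?exprn_ge0 ?(ltW M0)//.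
rewrite /d powRM ?(ltW rho0) ?density_ge0//.
have := powR_ge0 (density k z) p; have := hrho; nra.
Qed.

Lemma ball_sub_star k (x : Rn R n) : Rn_ball x (side k) `<=` star k (gidx M k x).
Proof.
move=> y xy i; have := Rn_ball_sup_lt i xy.
have xk : cube k (gidx M k x) x by apply/cubeP.
have := xk i; rewrite subr0 !intrD !intrN mulrDl mulrBl mulrDl mul1r.
rewrite ltr_norml => /andP[h1 h2] /andP[h3 h4].
by apply/andP; split; lra.
Qed.

(** Of the power [q] of the density, the part [q - p] is absorbed by [density_bound]; the remaining
    power [p <= 1] is the one that halves from parent to children. *)
Lemma annulus_term_le k x : G x ->
  (annulus_term M alpha q mu k x <=
   (e `^ q * density_bound `^ (q - p) * cube_energy k (gidx M k x))%:E)%E.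
Proof.
move=> xG; have /andP[p0 p1] := hp.
have zG : cube k (gidx M k x) `&` G !=set0 by exists x; split => //; apply/cubeP.
apply: (@le_trans _ _ (radial_weight n alpha q (mu (star k (gidx M k x))) (side k))).
  apply: le_radial_weight => //; apply: le_measure; rewrite ?inE.
  - exact: measurable_Rn_ball.
  - exact: measurable_gbox.
  - exact: ball_sub_star.
rewrite /radial_weight -[mu _]fineK ?mu_star_fin// -EFinM poweR_EFin lee_fin.
have -> : fine (mu (star k (gidx M k x))) * side k `^ (alpha - n%:R) =
    e * density k (gidx M k x) by rewrite /density mulrCA divff ?mulr1// gt_eqF.
rewrite powRM ?(ltW e0) ?density_ge0// -mulrA ler_wpM2l ?powR_ge0//.
rewrite /cube_energy ifT; last exact/asboolP.
set t := density k _.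
have -> : t `^ q = t `^ (q - p) * t `^ p.
  by rewrite -powRD subrK// gt_eqF.
rewrite ler_wpM2r ?powR_ge0// ge0_ler_powR ?nnegrE ?subr_ge0 ?density_ge0 ?powR_ge0//.
exact: density_le.
Qed.

End density.

(** * Whitney cubes *)

Section whitney.
Context (R : realType) (n M : nat).
Hypothesis M3 : (3 <= M)%N.
Variable Om : set (Rn R n).

Notation side := (side R M).
Notation cube := (gbox M 0 1).
Notation star := (gbox M 1 2).

Let s0 := side_gt0 R M3.

(** Expresses that the sup-norm distance to the complement of [Om] exceeds [r], without introducing
    this distance. *)
Definition inner (r : R) : set (Rn R n) :=
  [set x | forall y, (forall i : 'I_n, `|tnth y i - tnth x i| <= r) -> Om y].

Lemma inner_le r t : r <= t -> inner t `<=` inner r.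
Proof. by move=> rt x h y hy; apply: h => i; exact: le_trans (hy i) rt. Qed.

Lemma inner_sub r d x y : inner (r + d) x ->
  (forall i : 'I_n, `|tnth y i - tnth x i| <= d) -> inner r y.
Proof.
move=> hx hd w hw; apply: hx => i.
rewrite -(subrKA (tnth y i)); apply: le_trans (ler_normD _ _) _.
exact: lerD.
Qed.

(** The Whitney cubes are the cubes of level [k] that meet this layer. Those of different levels may
    intersect; only the bounded overlap of their doubles is used. *)
Definition whitney_layer (k : int) : set (Rn R n) :=
  inner (4 * side k) `\` inner (4 * side (k - 1)).

Lemma whitney_layer_exists x x0 r : 0 < r -> inner r x -> ~ Om x0 ->
  exists k, whitney_layer k x.
Proof.
move=> r0 xr x0O.
have [N hN] : exists N : nat, inner (4 * side N%:Z) x.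
  have [N hN] := side_small M3 (divr_gt0 r0 (ltr0n R 4)).
  exists N; apply: inner_le xr; rewrite mulrC -ler_pdivlMr//; exact: ltW.
have [N' hN'] : exists N' : nat, ~ inner (4 * side (- N'%:Z)) x.
  have [N' h] := side_large M3 (\sum_(i < n) `|tnth x0 i - tnth x i|).
  exists N' => hx; apply: x0O; apply: hx => i.
  apply: (@le_trans _ _ (side (- N'%:Z))); last first.
    by rewrite ler_peMl ?(ltW (s0 _))// ler1n.
  apply: le_trans (ltW h); rewrite (bigD1 i)//= lerDl.
  by apply: sumr_ge0.
(* Levels are counted from [- N'], where the condition fails, so that the coarsest admissible level
   is the minimum of a nonempty set of natural numbers. *)
pose P j := `[< inner (4 * side (j%:Z - N'%:Z)) x >].
have exP : exists j, P j.
  by exists (N + N')%N; apply/asboolP; rewrite PoszD addrK.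
have [m /asboolP Pm min] := ex_minnP exP.
exists (m%:Z - N'%:Z); split=> //.
case: m Pm min => [|m] Pm min; first by rewrite sub0r in Pm.
move=> h; suff : (m.+1 <= m)%N by rewrite ltnn.
apply: min; apply/asboolP.
by rewrite (_ : m%:Z - N'%:Z = m.+1%:Z - N'%:Z - 1)//; lia.
Qed.

Definition cube_center (k : int) (z : {ffun 'I_n -> int}) : Rn R n :=
  [tuple (z i)%:~R * side k + side k / 2 | i < n].

Lemma cube_sub_Rn_cube k z : cube k z `<=` Rn_cube (cube_center k z) (side k).
Proof.
move=> x /= xz i; have := xz i; rewrite tnth_mktuple subr0 intrD mulrDl mul1r.
move=> /andP[h1 h2]; rewrite ler_norml; apply/andP; split; lra.
Qed.

Lemma Rn_cube2_sub_star k z : Rn_cube (cube_center k z) (2 * side k) `<=` star k z.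
Proof.
move=> x /= xz i; have := xz i; rewrite tnth_mktuple !intrD !intrN.
rewrite !(mulrBl, mulrDl) mul1r ler_norml => /andP[h1 h2].
by have := s0 k => ?; apply/andP; split; lra.
Qed.

(** The first half places the double in [Om]; both halves together determine the level up to 1 from
    any point of the double. *)
Lemma Rn_cube2_inner k z y : cube k z `&` whitney_layer k !=set0 ->
  Rn_cube (cube_center k z) (2 * side k) y ->
  inner (2 * side k) y /\ ~ inner (2 * side (k - 1 - 1)) y.
Proof.
case=> x [xz [x1 x2]] yz.
have d (i : 'I_n) : `|tnth y i - tnth x i| <= 2 * side k.
  have := xz i; have /= := yz i; rewrite tnth_mktuple subr0 intrD.
  rewrite !(mulrBl, mulrDl) mul1r !ler_norml => /andP[h1 h2] /andP[h3 h4].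
  by have := s0 k => ?; apply/andP; split; lra.
split; first by apply: inner_sub d; apply: inner_le x1; lra.
move=> h; apply: x2; apply: (@inner_sub _ (2 * side k) y); last first.
  by move=> i; rewrite distrC.
apply: inner_le h.
have M3' : 3 <= M%:R :> R by rewrite ler_nat.
have e1 : side (k - 1) = M%:R * side k by rewrite (sideS R M3 (k - 1)) subrK.
have e2 : side (k - 1 - 1) = M%:R * side (k - 1).
  by rewrite (sideS R M3 (k - 1 - 1)) subrK.
(* In units of [side k]: radius [2 * M ^ 2] at [y], less the distance 2 from [y] to [x], still
   exceeds the radius [4 * M] excluded at [x]. This needs [M >= 3]. *)
have h0 : 0 <= 2 * (M%:R * M%:R) - 4 * M%:R - 2 :> R by nra.
rewrite e2 e1 -subr_ge0.
rewrite [leRHS](_ : _ = (2 * (M%:R * M%:R) - 4 * M%:R - 2) * side k); last by ring.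
by rewrite mulr_ge0 ?(ltW (s0 k)).
Qed.

(** Pairs of level and index are enumerated through [pickle_inv] to give a family indexed by [nat],
    padded with empty sets. *)
Definition whitney_double (i : nat) : set (Rn R n) :=
  if @pickle_inv (int * {ffun 'I_n -> int})%type i is Some (k, z) then
    if `[< cube k z `&` whitney_layer k !=set0 >] then
      Rn_cube (cube_center k z) (2 * side k) else set0
  else set0.

Lemma whitney_doubleP i x : whitney_double i x -> exists k z,
  [/\ @pickle_inv (int * {ffun 'I_n -> int})%type i = Some (k, z),
      cube k z `&` whitney_layer k !=set0 &
      Rn_cube (cube_center k z) (2 * side k) x].
Proof.
rewrite /whitney_double; case: pickle_inv => [[k z]|]//.
by case: asboolP => // h hx; exists k, z.
Qed.

Lemma whitney_double_sub i : whitney_double i `<=` Om.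
Proof.
move=> x /whitney_doubleP[k [z [_ h /(Rn_cube2_inner h)[hx _]]]].
by apply: hx => j; rewrite subrr normr0 mulr_ge0// ltW.
Qed.

(** The levels of doubles containing [x] differ by at most 1 from that of a fixed one, which leaves
    three levels; on each there are at most [3 ^ n] cubes, because doubles lie in the dilates. *)
Lemma whitney_double_overlap x m :
  (count (fun i => x \in whitney_double i) (iota 0 m) <= 3 * 3 ^ n)%N.
Proof.
have [[i0 /whitney_doubleP[k1 [z1 [_ h1 /(Rn_cube2_inner h1)[in1 nin1]]]]]|h] :=
    pselect (exists i, whitney_double i x); last first.
  rewrite (eq_count (a2 := pred0)) ?count_pred0// => i /=.
  by apply/negbTE/negP; rewrite inE => hi; apply: h; exists i.
pose g i : 'I_3 * {ffun 'I_n -> 'I_3} :=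
  if @pickle_inv (int * {ffun 'I_n -> int})%type i is Some (k, z) then
    (inord `|(k - k1 + 1)%R|%N, offset M k x z) else (ord0, [ffun=> ord0]).
have -> : (3 * 3 ^ n)%N = #|{: 'I_3 * {ffun 'I_n -> 'I_3}}|.
  by rewrite card_prod card_ffun !card_ord.
have lvl k k' : inner (2 * side k) x -> ~ inner (2 * side (k' - 1 - 1)) x ->
    k' - 1 <= k.
  move=> hk hk'; rewrite leNgt; apply/negP => kk'; apply: hk'.
  by apply: inner_le hk; rewrite ler_pM2l//; apply: ler_side => //; lia.
apply: (@count_leq_card _ _ _ _ g); first exact: iota_uniq.
move=> i j; rewrite !inE => /whitney_doubleP[k [z [ei hi xi]]].
move=> /whitney_doubleP[k' [z' [ej hj xj]]].
have [in2 nin2] := Rn_cube2_inner hi xi; have [in3 nin3] := Rn_cube2_inner hj xj.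
rewrite /g ei ej => -[/(congr1 val) /= + eo].
have l1 := lvl _ _ in1 nin2; have l2 := lvl _ _ in2 nin1.
have l3 := lvl _ _ in1 nin3; have l4 := lvl _ _ in3 nin1.
rewrite !inordK; [|lia..] => ek.
have kk : k = k' by lia.
have zz : z = z'.
  apply: (@offset_inj R n M M3 k x); [exact: Rn_cube2_sub_star xi| |].
    by rewrite kk; exact: Rn_cube2_sub_star xj.
  by rewrite eo kk.
have := @pickle_invK (int * {ffun 'I_n -> int})%type i.
have := @pickle_invK (int * {ffun 'I_n -> int})%type j.
by rewrite ei ej kk zz /= => -> ->.
Qed.

End whitney.

(** * Weak A_infinity weights *)

Section weights.
Context (R : realType) (n : nat).

Lemma measurable_Rn_leb (A : set (Rn R n)) :
  measurable A -> measurable (A : set (Rn_leb R n)).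
Proof. exact: caratheodory_measurable_mu_ext. Qed.

Lemma lebesgueE (A : set (Rn R n)) :
  measurable A -> lebesgue R n A = borel_lebesgue R n A.
Proof. by move=> mA; rewrite /lebesgue /= /completed_measure_extension measurable_mu_extE. Qed.

Lemma Rn_cubeE (c : Rn R n) l : Rn_cube c l =
  [set x : Rn R n | forall i : 'I_n, `[tnth c i - l / 2, tnth c i + l / 2]%classic (tnth x i)].
Proof.
apply/seteqP; split => x /= h i; have := h i.
  by rewrite in_itv/= ler_norml => /andP[h1 h2]; apply/andP; split; lra.
by rewrite in_itv/= ler_norml => /andP[h1 h2]; apply/andP; split; lra.
Qed.

Lemma borel_Rn_cube (c : Rn R n) l : measurable (Rn_cube c l : set (Rn R n)).
Proof.
rewrite Rn_cubeE; apply: (measurable_box (A := fun i =>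
  `[tnth c i - l / 2, tnth c i + l / 2]%classic)) => i.
exact: measurable_itv.
Qed.

Lemma measurable_Rn_cube (c : Rn R n) l : measurable (Rn_cube c l).
Proof. by apply: measurable_Rn_leb; exact: borel_Rn_cube. Qed.

Lemma lebesgue_Rn_cube (c : Rn R n) l : 0 < l ->
  lebesgue R n (Rn_cube c l) = (l ^+ n)%:E.
Proof.
move=> l0; rewrite lebesgueE; last exact: borel_Rn_cube.
rewrite Rn_cubeE (borel_lebesgue_box (A := fun i =>
  `[tnth c i - l / 2, tnth c i + l / 2]%classic)); last first.
  by move=> i; exact: measurable_itv.
rewrite (eq_bigr (fun=> l%:E)) => [|i _]; last first.
  rewrite lebesgue_measure_itv /= lte_fin ltrD2l gtrN ?divr_gt0//.
  by rewrite -EFinD; congr (_%:E); field.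
by rewrite prodEFin prodr_const card_ord.
Qed.

Variables (Csigma theta : R) (sigma : Rn_leb R n -> R).
Hypothesis hsigma : weak_Ainfty Csigma theta sigma.

Let sigma0 x : (0 <= (sigma x)%:E)%E.
Proof. by rewrite lee_fin; case: hsigma => + _ _ _ _; apply. Qed.

Lemma weighted_ge0 E : (0 <= weighted sigma E)%E.
Proof. by apply: integral_ge0 => x _; exact: sigma0. Qed.

Lemma le_weighted A B : A `<=` B -> (weighted sigma A <= weighted sigma B)%E.
Proof. by apply: ge0_le_integral_subset => x; exact: sigma0. Qed.

Lemma measurable_weight : measurable_fun [set: Rn_leb R n] (EFin \o sigma).
Proof. by apply/measurable_EFinP; case: hsigma. Qed.

Lemma weighted_Rn_cube_le (c : Rn R n) l (E : set (Rn R n)) (d : R) : 0 < l -> 0 <= d ->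
  measurable E -> E `<=` Rn_cube c l ->
  (borel_lebesgue R n E <= (d * l ^+ n)%:E)%E ->
  (weighted sigma E <= (Csigma * d `^ theta)%:E * weighted sigma (Rn_cube c (2 * l)))%E.
Proof.
move=> l0 d0 mE El Ed; case: hsigma => _ _ C0 t0 /(_ c l E l0 (measurable_Rn_leb mE) El).
move=> /le_trans; apply; rewrite lee_wpmul2r ?weighted_ge0// EFinM.
rewrite lee_wpmul2l ?lee_fin ?(ltW C0)// -poweR_EFin lebesgue_Rn_cube// lebesgueE//.
have ln : 0 < l ^+ n by exact: exprn_gt0.
rewrite inver gt_eqF//.
have h0 : (0 <= borel_lebesgue R n E * ((l ^+ n)^-1)%:E)%E.
  by rewrite mule_ge0// lee_fin invr_ge0 ltW.
apply: gt0_ler_poweR; rewrite ?in_itv/= ?leey ?andbT ?lee_fin ?(ltW t0)//.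
rewrite -[d](mulfK (lt0r_neq0 ln)) EFinM lee_wpmul2r//.
by rewrite lee_fin invr_ge0 ltW.
Qed.

(* Compare a fixed cube of positive mass with larger and larger concentric cubes. *)
Lemma weighted_setT : (1 <= n)%N ->
  weighted sigma setT = 0%E \/ weighted sigma setT = +oo%E.
Proof.
move=> n1; have [C0 t0] : 0 < Csigma /\ 0 < theta by case: hsigma.
have [->|Wfin] := eqVneq (weighted sigma setT) +oo%E; [by right|left].
have {}Wfin : weighted sigma setT \is a fin_num.
  by rewrite ge0_fin_numE ?weighted_ge0// ltey.
pose o : Rn R n := [tuple 0 | i < n].
pose W := fine (weighted sigma setT).
have W0 : 0 <= W by rewrite fine_ge0// weighted_ge0.
have cube0 l : 0 < l -> weighted sigma (Rn_cube o l) = 0%E.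
  move=> l0; apply/eqP; rewrite eq_le weighted_ge0 andbT leNgt; apply/negP => a0.
  have afin : weighted sigma (Rn_cube o l) \is a fin_num.
    rewrite ge0_fin_numE ?weighted_ge0//; apply: le_lt_trans (le_weighted _) _.
      exact: subsetT.
    by rewrite -ge0_fin_numE ?weighted_ge0.
  rewrite -(fineK afin) lte_fin in a0; set a := fine _ in a0.
  (* In the cube of side [l * t] the given one has density at most [t^-1]; this [t] is just large
     enough for [Csigma * t^-theta * W < a], a contradiction. *)
  pose t := 1 + (Csigma * W / a) `^ theta^-1.
  have y0 : 0 <= Csigma * W / a by rewrite !mulr_ge0 ?invr_ge0 ?(ltW C0)// ltW.
  have t1 : 1 <= t by rewrite lerDl powR_ge0.
  have t00 : 0 < t by exact: lt_le_trans t1.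
  have : (weighted sigma (Rn_cube o l) <= (Csigma * (t^-1) `^ theta)%:E * W%:E)%E.
    apply: le_trans (_ : (Csigma * (t^-1) `^ theta)%:E *
        weighted sigma (Rn_cube o (2 * (l * t))) <= _)%E.
      apply: weighted_Rn_cube_le; rewrite ?mulr_gt0 ?invr_ge0 ?(ltW t00)//.
      - exact: borel_Rn_cube.
      - move=> x hx i; apply: le_trans (hx i) _.
        by rewrite ler_pM2r// ler_peMr// ltW.
      rewrite -lebesgueE; last exact: borel_Rn_cube.
      rewrite lebesgue_Rn_cube// lee_fin exprMn mulrCA.
      rewrite ler_peMr ?exprn_ge0 ?(ltW l0)// mulrC ler_pdivlMr// mul1r.
      exact: ler_eXnr.
    rewrite /W fineK// lee_wpmul2l ?le_weighted//.
    by rewrite lee_fin mulr_ge0 ?powR_ge0 ?ltW.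
  rewrite -(fineK afin) -EFinM lee_fin -/a; apply/negP; rewrite -ltNge.
  have yt : Csigma * W / a < t `^ theta.
    have -> : Csigma * W / a = ((Csigma * W / a) `^ theta^-1) `^ theta.
      by rewrite -powRrM mulVf ?gt_eqF// powRr1.
    by rewrite gt0_ltr_powR ?nnegrE ?powR_ge0 ?(ltW t00)// /t ltrDr.
  have -> : t^-1 `^ theta = (t `^ theta)^-1.
    by rewrite -[t^-1]powR_inv1 ?(ltW t00)// -powRrM mulN1r powRN.
  rewrite mulrAC ltr_pdivrMr ?powR_gt0//.
  by rewrite [ltRHS]mulrC -ltr_pdivrMr.
apply/eqP; rewrite eq_le weighted_ge0 andbT.
(* The whole space is a countable union of null cubes: the covering lemma is used with empty [D i]
   and [eta = 0]. *)
have : (weighted sigma setT <= (0 * 1%:R)%:E * weighted sigma setT)%E.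
  apply: (@integral_countable_cover _ _ _ (lebesgue R n)
    (fun N => Rn_cube o N.+1%:R) (fun=> set0) setT setT (EFin \o sigma) 1 0).
  - by move=> N; exact: measurable_Rn_cube.
  - by move=> N; exact: measurable0.
  - exact: measurable_weight.
  - exact: sigma0.
  - exact: lexx.
  - move=> x _; exists (Num.bound (2 * \sum_(i < n) `|tnth x i|)) => // i.
    rewrite tnth_mktuple subr0.
    have S0 : 0 <= 2 * \sum_(j < n) `|tnth x j| by rewrite mulr_ge0// sumr_ge0.
    have h := archi_boundP S0.
    have hi : `|tnth x i| <= \sum_(j < n) `|tnth x j|.
      by rewrite (bigD1 i)//= lerDl sumr_ge0.
    by rewrite ler_pdivlMr// -natr1; lra.
  - by move=> N; exact: sub0set.
  - by move=> x m; rewrite (eq_count (a2 := pred0)) ?count_pred0// => i /=; rewrite in_set0.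
  - by move=> N; rewrite mul0e -[leLHS]/(weighted _ _) cube0.
by rewrite mul0r mul0e.
Qed.

End weights.

(** * The good lambda inequality *)

Section good_lambda.
Context (R : realType) (n M : nat) (alpha q : R).
Variable mu : {measure set (Rn R n) -> \bar R}.
Hypotheses (M3 : (3 <= M)%N) (halpha : alpha < n%:R) (hq : 0 < q).

Notation side := (side R M).
Notation cube := (gbox M 0 1).

Let s0 := side_gt0 R M3.

Lemma potentialE x : potential alpha q mu x = (energy alpha q mu x `^ q^-1)%E.
Proof. by []. Qed.

Lemma energy_ge0 x : (0 <= energy alpha q mu x)%E.
Proof.
apply: integral_ge0 => r; rewrite /= in_itv/= andbT; exact: radial_ge0.
Qed.

Lemma lt_potential lam x : 0 < lam ->
  (lam%:E < potential alpha q mu x)%E = ((lam `^ q)%:E < energy alpha q mu x)%E.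
Proof.
move=> l0; rewrite potentialE; have := energy_ge0 x.
case: (energy alpha q mu x) => [E| |]//; last first.
  by rewrite poweRyr ?invr_eq0 ?gt_eqF// !ltry.
rewrite lee_fin poweR_EFin !lte_fin => E0.
have qV : 0 < q^-1 by rewrite invr_gt0.
have {1}-> : lam = (lam `^ q) `^ q^-1.
  by rewrite -powRrM mulfV ?gt_eqF// powRr1// ltW.
case: (ltP (lam `^ q) E) => h.
  by rewrite gt0_ltr_powR ?nnegrE ?powR_ge0.
by apply/negbTE; rewrite -leNgt ge0_ler_powR ?nnegrE ?powR_ge0// ltW.
Qed.

(** Number of levels by which a radius is enlarged so that a ball about [y] swallows the ball about
    [x], when the coordinates of [x] and [y] differ by at most [5 * M] radii; [shift_const] is the
    cost. *)
Definition shift : nat := n * (5 * M).+1.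

Definition shift_const : R := (M%:R ^+ shift) `^ ((n%:R - alpha) * q).

Lemma shift_lt : n%:R * (5 * M%:R + 1) < M%:R ^+ shift :> R.
Proof.
rewrite -natrX -natrM natr1 -natrM ltr_nat /shift.
by apply: ltn_expl; apply: leq_trans M3.
Qed.

Lemma annulus_term_shift j (x y : Rn R n) :
  (forall i : 'I_n, `|tnth x i - tnth y i| <= 5 * M%:R * side j) ->
  (annulus_term M alpha q mu j x <=
   shift_const%:E * annulus_term M alpha q mu (j - shift%:Z) y)%E.
Proof.
move=> xy; have sE : side (j - shift%:Z) = M%:R ^+ shift * side j.
  by rewrite sideD// side_nat mulrC.
have M0 : (0 : R) < M%:R ^+ shift by rewrite exprn_gt0// ltr0n (leq_trans _ M3).
rewrite /annulus_term {2}sE radial_weight_scale// muleA -EFinM mulfV; last first.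
  by rewrite gt_eqF// powR_gt0.
rewrite mul1e; apply: le_radial_weight => //; apply: le_mu_ball => w xw.
apply: (@sup_le_Rn_ball _ _ _ _ ((5 * M%:R + 1) * side j)).
- by rewrite mulr_ge0 ?addr_ge0 ?mulr_ge0 ?(ltW (s0 _)).
- move=> i; rewrite -(subrKA (tnth x i)) mulrDl mul1r addrC.
  apply: le_trans (ler_normD _ _) _; apply: lerD => //.
  exact/ltW/Rn_ball_sup_lt.
- by rewrite sE mulrA ltr_pM2r// shift_lt.
Qed.

(** All levels in the sum are at most [k - 1], so a displacement measured by [side (k - 1)] is
    admissible for every term, and the shifted terms are again consecutive. *)
Lemma sum_annulus_shift k N (x y : Rn R n) :
  (forall i : 'I_n, `|tnth x i - tnth y i| <= 5 * M%:R * side (k - 1)) ->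
  (\sum_(j < N) annulus_term M alpha q mu (k - N%:Z + j%:Z) x <=
   (shift_const * (2 * shift_cost n M alpha q))%:E * energy alpha q mu y)%E.
Proof.
move=> xy.
apply: (@le_trans _ _ (\sum_(j < N) shift_const%:E *
    annulus_term M alpha q mu (k - N%:Z - shift%:Z + j%:Z) y)%E).
  apply: lee_sum => j _.
  rewrite (_ : k - N%:Z - shift%:Z + j%:Z = k - N%:Z + j%:Z - shift%:Z); last by lia.
  apply: annulus_term_shift => i; apply: le_trans (xy i) _.
  rewrite ler_wpM2l ?mulr_ge0//; apply: ler_side => //.
  by have := ltn_ord j; lia.
rewrite -ge0_sume_distrr => [|j _]; last exact: annulus_term_ge0.
rewrite EFinM -muleA lee_wpmul2l ?lee_fin ?powR_ge0//.
exact: sum_annulus_le_energy.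
Qed.

(** In [tau ^ q], the factor [shift_cost * M] pays for discretising the integral. In the last
    factor, the first summand pays for the coarse terms, and the summand 1 leaves [lam ^ q] to the
    local ones. *)
Definition tau : R := (shift_cost n M alpha q * M%:R *
  (shift_const * (2 * shift_cost n M alpha q) + 1)) `^ q^-1.

Lemma shift_cost_ge1 : 1 <= shift_cost n M alpha q.
Proof.
rewrite /shift_cost -[leLHS](powRr0 M%:R); apply: ler_powR.
  by rewrite ler1n (leq_trans _ M3).
by rewrite mulr_ge0 ?subr_ge0 ?ltW.
Qed.

Let A0 : 0 < shift_cost n M alpha q * M%:R.
Proof. by rewrite mulr_gt0 ?shift_cost_gt0// ltr0n (leq_trans _ M3). Qed.

Let K0 : 0 <= shift_const * (2 * shift_cost n M alpha q).
Proof. by rewrite mulr_ge0 ?powR_ge0// mulr_ge0// ltW// shift_cost_gt0. Qed.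

Lemma tau_gt1 : 1 < tau.
Proof.
have A1 : 1 < shift_cost n M alpha q * M%:R.
  apply: (@lt_le_trans _ _ M%:R); first by rewrite ltr1n (leq_trans _ M3).
  by rewrite ler_peMl// shift_cost_ge1.
have -> : (1 : R) = 1 `^ q^-1 by rewrite powR1.
rewrite gt0_ltr_powR ?invr_gt0 ?nnegrE//.
  by rewrite mulr_ge0 ?(ltW A0)// addr_ge0.
by apply: lt_le_trans A1 _; rewrite ler_peMr ?(ltW A0)// lerDr.
Qed.

Lemma lt_potential_tau lam x k : 0 < lam -> ((tau * lam)%:E < potential alpha q mu x)%E ->
  exists N, (((shift_const * (2 * shift_cost n M alpha q) + 1) * lam `^ q)%:E <
    \sum_(j < N + N) annulus_term M alpha q mu (k - N%:Z + j%:Z) x)%E.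
Proof.
move=> l0; have t0 := lt_trans ltr01 tau_gt1; rewrite lt_potential ?mulr_gt0//.
rewrite powRM ?(ltW t0) ?(ltW l0)// -powRrM mulVf ?gt_eqF// powRr1; last first.
  by rewrite mulr_ge0 ?(ltW A0)// addr_ge0.
move=> /(energy_gt_sum_annulus M3 halpha hq k)[N]; rewrite -mulrA EFinM.
by rewrite lte_pmul2l ?lte_fin// => hN; exists N.
Qed.

(** Takes the place of openness of the superlevel set: finitely many terms already exceed the
    threshold at [x], and moving them to a nearby [y] costs no more than [tau] allows. *)
Lemma inner_lt_potential lam x : 0 < lam -> ((tau * lam)%:E < potential alpha q mu x)%E ->
  exists2 r, 0 < r & inner [set y | (lam%:E < potential alpha q mu y)%E] r x.
Proof.
move=> l0 /(lt_potential_tau 0 l0)[N hN].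
(* The finest level of the window is [N - 1], so this displacement is admissible for all of its
   terms. *)
exists (side (N%:Z - 1)) => // y hy /=; rewrite lt_potential//.
have h : (\sum_(j < N + N) annulus_term M alpha q mu (0 - N%:Z + j%:Z) x <=
    (shift_const * (2 * shift_cost n M alpha q))%:E * energy alpha q mu y)%E.
  rewrite (_ : 0 - N%:Z = N%:Z - (N + N)%N%:Z); last by lia.
  apply: sum_annulus_shift => i; rewrite distrC; apply: le_trans (hy i) _.
  rewrite ler_peMl ?(ltW (s0 _))// -natrM ler1n muln_gt0/=.
  exact: leq_trans M3.
have {hN h} := lt_le_trans hN h.
have := energy_ge0 y; case: (energy _ _ _ y) => [E| |]//; last by rewrite ltry.
rewrite lee_fin -EFinM !lte_fin => E0 h; rewrite ltNge; apply/negP => El.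
move: h; apply/negP; rewrite -leNgt [leRHS]mulrDl mul1r.
apply: le_trans (ler_wpM2l K0 El) _; rewrite lerDl; exact: powR_ge0.
Qed.

(** The window splits at level [k]. The coarse half is moved to [x0], where the energy is at most
    [lam ^ q]; what [tau] leaves over must come from the fine half. *)
Lemma lt_potential_local lam x x0 k : 0 < lam ->
  ((tau * lam)%:E < potential alpha q mu x)%E ->
  (potential alpha q mu x0 <= lam%:E)%E ->
  (forall i : 'I_n, `|tnth x i - tnth x0 i| <= 5 * M%:R * side (k - 1)) ->
  exists J, ((lam `^ q)%:E < \sum_(j < J) annulus_term M alpha q mu (k + j%:Z) x)%E.
Proof.
move=> l0 /(lt_potential_tau k l0)[N hN] hx0 xx0; exists N.
have Ex0 : (energy alpha q mu x0 <= (lam `^ q)%:E)%E.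
  by rewrite leNgt -lt_potential// -leNgt.
have h1 := le_trans (sum_annulus_shift N xx0) (lee_wpmul2l (_ : 0%R <= _%:E)%E Ex0).
move: hN; rewrite big_split_ord /=.
under [X in (_ + X)%E]eq_bigr do rewrite PoszD addrA subrK.
rewrite [X in (X%:E < _)%E]mulrDl mul1r EFinD => hN.
rewrite ltNge; apply/negP => h2; move: hN; apply/negP; rewrite -leNgt.
by apply: leeD => //; apply: le_trans (h1 _) _; rewrite ?lee_fin.
Qed.

End good_lambda.

Lemma ball_le_of_maximal (R : realType) (n : nat) (alpha e r : R)
    (mu : {measure set (Rn R n) -> \bar R}) (x : Rn R n) :
  (maximal alpha mu x <= e%:E)%E -> 0 < r ->
  (mu (Rn_ball x r) <= (e * r `^ (n%:R - alpha))%:E)%E.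
Proof.
move=> hx r0; have rp : 0 < r `^ (n%:R - alpha) by exact: powR_gt0.
have h : (mu (Rn_ball x r) * (r `^ (alpha - n%:R))%:E <= e%:E)%E.
  by apply: le_trans hx; apply: ereal_sup_ubound; exists r.
move: h; rewrite -opprB powRN.
by rewrite lee_pdivrMr// EFinM.
Qed.

(** Positivity of [alpha] enters here: it lets a large [M] outweigh the overlap [3 ^ n]. *)
Lemma exists_dilation (R : realType) (n : nat) (alpha rho : R) : 0 < alpha -> 0 < rho ->
  exists M : nat, (3 <= M)%N /\ (3 ^ n)%:R <= rho * M%:R `^ alpha.
Proof.
move=> a0 r0; pose y := ((3 ^ n)%:R / rho) `^ alpha^-1.
have y0 : 0 <= y by exact: powR_ge0.
exists (3 + Num.bound y)%N; split; first exact: leq_addr.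
rewrite mulrC -ler_pdivrMr//.
have -> : (3 ^ n)%:R / rho = y `^ alpha.
  by rewrite /y -powRrM mulVf ?gt_eqF// powRr1// divr_ge0// ltW.
rewrite ge0_ler_powR ?nnegrE ?(ltW a0)//.
apply: le_trans (ltW (archi_boundP y0)) _.
by rewrite ler_nat leq_addl.
Qed.

(** The powers of [lam] cancel, and the remaining [eps ^ q] becomes the exponent of the final
    estimate. *)
Lemma decay_lt (R : realType) (lam eps q t c S : R) :
  0 < lam -> 0 < eps -> 0 < c -> 0 < t ->
  lam `^ q < (eps * lam) `^ q * t * S -> c / t / eps `^ q < c * S.
Proof.
move=> l0 e0 c0 t0; rewrite powRM ?(ltW l0) ?(ltW e0)// => h.
have lq : 0 < lam `^ q by exact: powR_gt0.
have eq0 : 0 < eps `^ q by exact: powR_gt0.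
have {}h : 1 < eps `^ q * t * S.
  rewrite -(ltr_pM2l lq) mulr1; apply: (lt_le_trans h).
  by rewrite le_eqVlt; apply/orP; left; apply/eqP; ring.
rewrite -mulrA -invfM ltr_pM2l// -[_^-1]mul1r ltr_pdivrMr ?mulr_gt0//.
by rewrite mulrC [t * _]mulrC.
Qed.

(** * Exponential decay on the Whitney cubes and summation *)

Section whitney_estimate.
Context (R : realType) (n M : nat) (alpha q p rho Csigma theta lam eps : R).
Variables (mu : {measure set (Rn R n) -> \bar R}) (sigma : Rn_leb R n -> R).
Hypotheses (M3 : (3 <= M)%N) (n1 : (1 <= n)%N).
Hypotheses (halpha : alpha < n%:R) (hq : 0 < q) (hp : 0 < p <= 1) (pq : p <= q).
Hypotheses (rho0 : 0 < rho) (hrho : rho `^ p <= 4^-1).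
Hypothesis hM : (3 ^ n)%:R <= rho * M%:R `^ alpha.
Hypothesis hsigma : weak_Ainfty Csigma theta sigma.
Hypotheses (l0 : 0 < lam) (eps0 : 0 < eps).

Notation side := (side R M).
Notation cube := (gbox M 0 1).

Let s0 := side_gt0 R M3.
Let T0 : 0 < density_bound n alpha.
Proof. by rewrite powR_gt0// mulr_gt0// ltr0n. Qed.

(** Normalises the bounded cube energies to at most [1/4], as the induction for [excess]
    requires. *)
Definition excess_weight : R := (4 * density_bound n alpha `^ p)^-1.

Definition decay_rate : R := excess_weight / density_bound n alpha `^ (q - p).

Lemma excess_weight_gt0 : 0 < excess_weight.
Proof. by rewrite invr_gt0 mulr_gt0// powR_gt0. Qed.

Lemma decay_rate_gt0 : 0 < decay_rate.
Proof. by apply: divr_gt0; [exact: excess_weight_gt0|exact: powR_gt0]. Qed.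

Notation Om := [set x | (lam%:E < potential alpha q mu x)%E].
Notation G := [set x | (maximal alpha mu x <= (eps * lam)%:E)%E].
Notation bad := [set x | ((tau n M alpha q * lam)%:E < potential alpha q mu x)%E /\
                    (maximal alpha mu x <= (eps * lam)%:E)%E].
Notation b := (cube_energy M alpha p (eps * lam) mu G).
Notation u := (decay_rate / eps `^ q).
Let e0 : 0 < eps * lam. Proof. exact: mulr_gt0. Qed.

Let hG x r : G x -> 0 < r ->
  (mu (Rn_ball x r) <= (eps * lam * r `^ (n%:R - alpha))%:E)%E.
Proof. exact: ball_le_of_maximal. Qed.

Let b0 k z : 0 <= b k z. Proof. exact: cube_energy_ge0. Qed.

Let cb k z : excess_weight * b k z <= 4^-1.
Proof.
have h := cube_energy_le M3 n1 hp e0 hG k z.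
rewrite /excess_weight invfM -mulrA ler_piMr// mulrC ler_pdivrMr ?mul1r//.
exact: powR_gt0.
Qed.

Let b_child k z :
  \sum_v b (k + 1) (child (M := M) z v) <= M%:R ^+ n * (b k z / 2).
Proof. exact: (cube_energy_child (rho := rho)). Qed.

Definition bad_cover (k : int) (z : {ffun 'I_n -> int}) : set (Rn R n) :=
  \bigcup_J excess M b excess_weight J k z u.

Lemma bad_sub_cover x k : bad x -> whitney_layer M Om k x ->
  bad_cover k (gidx M k x) x.
Proof.
move=> [xt xm] [x1 x2].
(* The upper half of the layer condition supplies a point outside [Om] close enough for the coarse
   terms to be moved there. *)
have [x0 [hx0 nOm]] : exists x0, (forall i : 'I_n, `|tnth x0 i - tnth x i| <=
    4 * side (k - 1)) /\ ~ Om x0.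
  apply: contrapT => /forallNP h; apply: x2 => y hy.
  by apply: contrapT => ny; exact: (h y (conj hy ny)).
have [|i|J hJ] := lt_potential_local (k := k) M3 halpha hq l0 xt (x0 := x0).
- by rewrite leNgt; apply/negP.
- rewrite distrC; apply: le_trans (hx0 i) _; apply: ler_wpM2r.
    exact/ltW/s0.
  have : 3 <= M%:R :> R by rewrite ler_nat.
  lra.
exists J; first exact: I.
apply: (mem_excess M3 (ltW excess_weight_gt0)); first exact/cubeP.
set S := \sum_(j < J) _.
have : ((lam `^ q)%:E <
    ((eps * lam) `^ q * density_bound n alpha `^ (q - p) * S)%:E)%E.
  apply: (lt_le_trans hJ); rewrite /S mulr_sumr -sumEFin.
  by apply: lee_sum => j _; exact: annulus_term_le.
rewrite lte_fin.
exact: (decay_lt l0 eps0 excess_weight_gt0 (powR_gt0 _ T0)).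
Qed.

Lemma measurable_bad_cover k z : measurable (bad_cover k z).
Proof. exact: measurable_bigcup_excess. Qed.

Lemma weighted_bad_cover k z :
  (weighted sigma (bad_cover k z) <= (Csigma * (2 * expR (- u)) `^ theta)%:E *
     weighted sigma (Rn_cube (cube_center R M k z) (2 * side k)))%E.
Proof.
apply: (weighted_Rn_cube_le hsigma (s0 k)).
- by rewrite mulr_ge0 ?expR_ge0.
- exact: measurable_bad_cover.
- by move=> x [J _ /(excess_sub_cube M3)]; exact: cube_sub_Rn_cube.
- by apply: borel_lebesgue_bigcup_excess => //; exact: ltW excess_weight_gt0.
Qed.

(** A point outside [Om] guarantees that every bad point lies in some Whitney layer; the local
    estimates then add up over the doubles. *)
Lemma weighted_bad : (exists x0, ~ Om x0) ->
  (weighted sigma bad <= (Csigma * (2 * expR (- u)) `^ theta * (3 * 3 ^ n)%:R)%:E *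
     weighted sigma Om)%E.
Proof.
case=> x0 nOm.
pose F i : set (Rn_leb R n) :=
  if @pickle_inv (int * {ffun 'I_n -> int})%type i is Some (k, z) then
    if `[< cube k z `&` whitney_layer M Om k !=set0 >] then bad_cover k z else set0
  else set0.
apply: (@integral_countable_cover _ _ _ (lebesgue R n) F (whitney_double M Om)
    bad Om (EFin \o sigma)).
- move=> i; rewrite /F; case: pickle_inv => [[k z]|]; last exact: measurable0.
  case: ifP => _; last exact: measurable0.
  by apply: measurable_Rn_leb; exact: measurable_bad_cover.
- move=> i; rewrite /whitney_double; case: pickle_inv => [[k z]|]; last exact: measurable0.
  case: ifP => _; last exact: measurable0.
  exact: measurable_Rn_cube.
- exact: measurable_weight hsigma.
- by move=> x; rewrite lee_fin; case: hsigma.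
- by case: hsigma => _ _ C0 _ _; rewrite mulr_ge0 ?powR_ge0 ?ltW.
- move=> x xb; have [xt _] := xb.
  have [r r0 hr] := inner_lt_potential M3 halpha hq l0 xt.
  have [k hk] := whitney_layer_exists M3 r0 hr nOm.
  exists (pickle (k, gidx M k x)); first exact: I.
  rewrite /F pickleK_inv.
  rewrite ifT; first exact: bad_sub_cover.
  by apply/asboolP; exists x; split; [exact/cubeP|exact: hk].
- exact: whitney_double_sub.
- by move=> x m; exact: whitney_double_overlap.
- move=> i; rewrite /F /whitney_double; case: pickle_inv => [[k z]|]; last first.
    by rewrite !integral_set0 mule0.
  case: ifP => _; last by rewrite !integral_set0 mule0.
  exact: weighted_bad_cover.
Qed.

End whitney_estimate.

(** * Choice of constants, and the case where the potential exceeds lambda everywhere *)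

Theorem theorem1p1 (R : realType) (n : nat) (alpha q Csigma theta : R)
  (hn : (1 <= n)%N) (halpha : 0 < alpha < n%:R) (hq : 0 < q)
  (hC : 0 < Csigma) (htheta : 0 < theta) :
  exists tau C c : R,
    [/\ 1 < tau, 0 < C, 0 < c &
      forall sigma : Rn_leb R n -> R, weak_Ainfty Csigma theta sigma ->
      forall (mu : {measure set (Rn R n) -> \bar R}) (lambda eps : R),
        0 < lambda -> 0 < eps < 1 ->
        (weighted sigma [set x | (tau * lambda)%:E < potential alpha q mu x /\
                                 maximal alpha mu x <= (eps * lambda)%:E] <=
         (C * expR (- (c / eps `^ q)))%:E *
         weighted sigma [set x | lambda%:E < potential alpha q mu x])%E].
Proof.
have /andP[a0 an] := halpha.
(* This [rho] satisfies [rho ^ p = 1/4], which beats the factor 2 lost to the affine majorant by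
   another factor 2. *)
pose p := Num.min q 1; pose rho : R := 4^-1 `^ p^-1.
have p0 : 0 < p by rewrite lt_min hq ltr01.
have hp : 0 < p <= 1 by rewrite p0 ge_min lexx orbT.
have pq : p <= q by rewrite ge_min lexx.
have rho0 : 0 < rho by rewrite powR_gt0// invr_gt0.
have hrho : rho `^ p <= 4^-1.
  by rewrite /rho -powRrM mulVf ?gt_eqF// powRr1// invr_ge0.
have [M [M3 hM]] := exists_dilation n a0 rho0.
exists (tau n M alpha q), (Csigma * 2 `^ theta * (3 * 3 ^ n)%:R),
  (theta * decay_rate n alpha q p); split.
- exact: tau_gt1.
- by rewrite !mulr_gt0 ?powR_gt0// ltr0n muln_gt0 expn_gt0.
- by rewrite mulr_gt0// decay_rate_gt0.
move=> sigma hsigma mu lam eps l0 /andP[eps0 _].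
have [ex|nex] := pselect (exists x0, ~ (lam%:E < potential alpha q mu x0)%E).
  have := weighted_bad M3 hn an hq hp pq rho0 hrho hM hsigma l0 eps0 ex.
  congr (_ <= _%:E * _)%E; rewrite powRM ?expR_ge0// mulrA mulrAC; congr (_ * _).
  by rewrite -expRM; congr expR; ring.
have OmT : [set x | (lam%:E < potential alpha q mu x)%E] = setT.
  by apply/seteqP; split => // x _; apply: contrapT => h; apply: nex; exists x.
(* No Whitney decomposition exists here. With total mass 0 the left side vanishes; with infinite
   mass the right side is infinite. *)
rewrite OmT; case: (weighted_setT hsigma hn) => WT; rewrite WT.
  by rewrite mule0 -WT; apply: (le_weighted hsigma).
rewrite gt0_muley ?leey// lte_fin.
by rewrite !mulr_gt0 ?powR_gt0 ?expR_gt0// ltr0n muln_gt0 expn_gt0.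
Qed.
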